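(* In the co-primary spectrum sharing game $\mathcal G$, the uniqueness of the Nash equilibrium is guaranteed if every operator $i$ has a utility $U_i$ that is concave with respect to $\beta_i$.
   Context: $\mathcal G$ is a non-cooperative game among $N$ mobile network operators supporting device-to-device (D2D) communication. Operator $i$ chooses the fraction $\beta_i\in S_i=\{\beta_i:\beta_i^{min}\le\beta_i\le\beta_i^{max}(\delta_i)\}$ of its spectrum that it contributes to a common pool of size $\beta=\sum_{j=1}^N\beta_j$, which is used by inter-operator D2D pairs of all operators. Here $\beta_i^{min}>0$, and $\beta_i^{max}(\delta_i)$ is the largest contribution for which the operator's own rate constraints for cellular users and intra-operator D2D users can be met; it does not depend on the other operators' choices. The operator keeps the fraction $\beta_i^{cd}=1-\beta_i$ for its cellular and intra-operator D2D communications. In the intra-operator D2D overlay scheme this is split as $\beta_i^{cd}=\beta_i^c+\beta_i^d$ (cellular part $\beta_i^c$, intra-operator D2D part $\beta_i^d$), with the cellular rate constraint $\beta_i^cR_i^c=\tau_i^c$ met with equality for a target $\tau_i^c$; in the underlay scheme both types of communication use all of $\beta_i^{cd}$. The parameters $\delta_i$ and $q$ are the fractions of intra-operator and inter-operator D2D users, respectively, that communicate in D2D mode; $\delta_i$ is fixed at its selected value, and $q$ is common to all operators (in the numerical setting in which the result is stated, $q=\delta_i^{max}=1$, where $\delta_i^{max}$ is the largest admissible $\delta_i$). The utility of operator $i$ is either the weighted sum rate $U_i=(1-w_i^s)Q_i^d+w_i^sQ_i^s$ or the weighted proportional fair rate $U_i=(1-w_i^s)\log(Q_i^d)+w_i^s\log(Q_i^s)$,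 with weight $0\le w_i^s\le1$. Here $Q_i^d$ and $Q_i^s$ are the normalized average rates of the intra-operator and inter-operator D2D users. In the overlay scheme, $Q_i^d=\beta_i^cR_i^c(1-\delta_i)+\beta_i^dR_i^d\delta_i$ and $Q_i^s=\beta_i^cR_i^c(1-q)+\beta R^sq$; in the underlay scheme $\beta_i^c$ and $\beta_i^d$ are replaced by $\beta_i^{cd}$. The quantities $R_i^c$, $R_i^d$, $R^s$ are the average spectral efficiencies of the cellular, intra-operator D2D and inter-operator D2D modes. For each mode $m$, the average spectral efficiency is $\int_0^\infty \frac{\nu_m\mathcal P_m(\gamma)}{1+\gamma}\,d\gamma$, where $\nu_m$ is the portion of time a typical user is active in that mode, and $\mathcal P_m(\gamma)=\int_0^\infty f_m(d)\,e^{-\sigma^2 b_m s_m}\,\mathcal L_{I_m}(s_m)\,dd$ is the probability that the SINR exceeds $\gamma$ under Rayleigh fading. Here $f_m$ is the link distance density, $\sigma^2$ the noise power over the full cellular band, $b_m$ the bandwidth fraction used by the mode ($b_m=\beta$ for inter-operator D2D), $s_m=\gamma/(P_m l(d))$ with transmit power $P_m$ and distance-based pathloss function $l$, and $\mathcal L_{I_m}$ the Laplace transform of the aggregate interference. Base stations and users are located according to independent Poisson point processes. A Nash equilibrium is a profile $\boldsymbol\beta'\in S_1\times\cdots\times S_N$ such that $U_i(\beta_i',\boldsymbol\beta_{-i}')\ge U_i(\beta_i,\boldsymbol\beta_{-i}')$ for all $\beta_i\in S_i$ and all $i$, where $\boldsymbol\beta_{-i}'$ denotes the components of $\boldsymbol\beta'$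 other than the $i$-th.
   Formalization: Takes q = 1, the setting in which the result is stated, and assumes every δ_i > 0: for δ_i = 0 in the overlay scheme with w_i = 0 the utility is constant, hence concave, and the Nash equilibrium is not unique. *)

(* Defs.v *)
From mathcomp Require Import all_boot all_order all_algebra.
From mathcomp Require Import all_classical all_reals all_analysis.

Set Implicit Arguments.
Unset Strict Implicit.
Unset Printing Implicit Defensive.

Import Order.TTheory GRing.Theory Num.Theory.
Import numFieldNormedType.Exports.

Local Open Scope classical_set_scope.
Local Open Scope ring_scope.

(* [noise] is the noise power over the full cellular band. *)
Record environment (R : realType) := Environment {
  noise : R;
  pathloss : R -> R
}.

Record environment_ok (R : realType) (E : environment R) : Prop := {
  noise_gt0 : 0 < noise E;
  pathloss_gt0 : forall x : R, 0 < x -> 0 < pathloss E x;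
  measurable_pathloss : measurable_fun (`]0, +oo[ : set R) (pathloss E)
}.

(* A communication mode.  [interference] is the aggregate interference at a
   typical receiver; its law is arbitrary, which covers in particular the
   interference created by Poisson point processes of transmitters. *)
Record mode (R : realType) (d : measure_display) (T : measurableType d)
    (P : probability T R) := Mode {
  activity : R;
  power : R;
  link_density : R -> R;
  interference : {RV P >-> R}
}.

(* Laplace transform of the interference: E[exp(- s I)]. *)
Definition laplace (R : realType) (d : measure_display) (T : measurableType d)
    (P : probability T R) (m : mode P) (s : R) : R :=
  fine ('M_P (interference m) (- s)).

Definition sinr_arg (R : realType) (d : measure_display)
    (T : measurableType d) (P : probability T R) (E : environment R)
    (m : mode P) (gamma x : R) : R :=
  gamma / (power m * pathloss E x).

(* Probability, under Rayleigh fading, that the SINR of mode [m] exceeds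
   [gamma] when the mode uses the bandwidth fraction [b]. *)
Definition coverage (R : realType) (d : measure_display)
    (T : measurableType d) (P : probability T R) (E : environment R)
    (m : mode P) (b gamma : R) : R :=
  \int[lebesgue_measure]_(x in `]0, +oo[)
    (link_density m x * expR (- (noise E * b * sinr_arg E m gamma x))
       * laplace m (sinr_arg E m gamma x)).

Definition efficiency_density (R : realType) (d : measure_display)
    (T : measurableType d) (P : probability T R) (E : environment R)
    (m : mode P) (b gamma : R) : R :=
  activity m * coverage E m b gamma / (1 + gamma).

Definition spectral_efficiency (R : realType) (d : measure_display)
    (T : measurableType d) (P : probability T R) (E : environment R)
    (m : mode P) (b : R) : R :=
  \int[lebesgue_measure]_(gamma in `[0, +oo[) efficiency_density E m b gamma.

Definition band_rate (R : realType) (d : measure_display)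
    (T : measurableType d) (P : probability T R) (E : environment R)
    (m : mode P) (b : R) : R :=
  b * spectral_efficiency E m b.

(* The last field says that the average spectral efficiencies are finite; the
   real-valued integral would otherwise take a default value. *)
Record mode_ok (R : realType) (d : measure_display) (T : measurableType d)
    (P : probability T R) (E : environment R) (m : mode P) : Prop := {
  activity_gt0 : 0 < activity m;
  activity_le1 : activity m <= 1;
  power_gt0 : 0 < power m;
  link_density_ge0 : forall x : R, 0 < x -> 0 <= link_density m x;
  measurable_link_density : measurable_fun (`]0, +oo[ : set R) (link_density m);
  link_density_total :
    (\int[lebesgue_measure]_(x in `]0%R, +oo[) (link_density m x)%:E = 1)%E;
  interference_ge0 : forall t : T, 0 <= interference m t;
  efficiency_finite : forall b : R, 0 < b ->
    lebesgue_measure.-integrable `[0, +oo[ (EFin \o efficiency_density E m b)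
}.

Inductive intra_scheme := Overlay | Underlay.

Inductive utility_kind := SumRate | ProportionalFair.

(* The intra-operator D2D scheme and the utility may differ from one operator
   to another. *)
Record game (R : realType) (d : measure_display) (T : measurableType d)
    (P : probability T R) (N : nat) := Game {
  env : environment R;
  cell_mode : 'I_N -> mode P;
  intra_mode : 'I_N -> mode P;
  inter_mode : mode P;
  scheme : 'I_N -> intra_scheme;
  kind : 'I_N -> utility_kind;
  weight : 'I_N -> R;
  intra_fraction : 'I_N -> R; (* delta_i *)
  inter_fraction : R; (* q *)
  cell_target : 'I_N -> R;
  intra_target : 'I_N -> R;
  overlay_cell_band : 'I_N -> R; (* beta_i^c in the overlay scheme *)
  min_contribution : 'I_N -> R;
  max_contribution : 'I_N -> R
}.

Definition own_band (R : realType) (x : R) : R := 1 - x.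

Definition cell_band (R : realType) (d : measure_display)
    (T : measurableType d) (P : probability T R) (N : nat) (G : game P N)
    (i : 'I_N) (x : R) : R :=
  match scheme G i with
  | Overlay => overlay_cell_band G i
  | Underlay => own_band x
  end.

Definition intra_band (R : realType) (d : measure_display)
    (T : measurableType d) (P : probability T R) (N : nat) (G : game P N)
    (i : 'I_N) (x : R) : R :=
  match scheme G i with
  | Overlay => own_band x - overlay_cell_band G i
  | Underlay => own_band x
  end.

(* [beta_c R_c] when operator [i] contributes [x]. *)
Definition cell_rate (R : realType) (d : measure_display)
    (T : measurableType d) (P : probability T R) (N : nat) (G : game P N)
    (i : 'I_N) (x : R) : R :=
  band_rate (env G) (cell_mode G i) (cell_band G i x).

(* Q_i^d when operator [i] contributes [x]. *)
Definition intra_rate (R : realType) (d : measure_display)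
    (T : measurableType d) (P : probability T R) (N : nat) (G : game P N)
    (i : 'I_N) (x : R) : R :=
  cell_rate G i x * (1 - intra_fraction G i)
  + band_rate (env G) (intra_mode G i) (intra_band G i x)
    * intra_fraction G i.

Definition pool (R : realType) (N : nat) (beta : 'I_N -> R) : R :=
  \sum_(j < N) beta j.

(* Q_i^s at the profile [beta]. *)
Definition inter_rate (R : realType) (d : measure_display)
    (T : measurableType d) (P : probability T R) (N : nat) (G : game P N)
    (i : 'I_N) (beta : 'I_N -> R) : R :=
  cell_rate G i (beta i) * (1 - inter_fraction G)
  + band_rate (env G) (inter_mode G) (pool beta) * inter_fraction G.

Definition utility (R : realType) (d : measure_display)
    (T : measurableType d) (P : probability T R) (N : nat) (G : game P N)
    (i : 'I_N) (beta : 'I_N -> R) : R :=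
  match kind G i with
  | SumRate => (1 - weight G i) * intra_rate G i (beta i)
               + weight G i * inter_rate G i beta
  | ProportionalFair => (1 - weight G i) * ln (intra_rate G i (beta i))
                        + weight G i * ln (inter_rate G i beta)
  end.

(* The contributions for which operator [i] meets its own rate constraints. *)
Definition feasible (R : realType) (d : measure_display)
    (T : measurableType d) (P : probability T R) (N : nat) (G : game P N)
    (i : 'I_N) (x : R) : Prop :=
  [/\ 0 <= x <= 1, 0 <= intra_band G i x, cell_target G i <= cell_rate G i x
    & intra_target G i <= intra_rate G i x].

(* [intra_fraction_gt0]: with the overlay scheme and weight 0, the utility
   would be constant for [delta_i = 0]. *)
Record game_ok (R : realType) (d : measure_display) (T : measurableType d)
    (P : probability T R) (N : nat) (G : game P N) : Prop := {
  env_ok : environment_ok (env G);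
  cell_mode_ok : forall i, mode_ok (env G) (cell_mode G i);
  intra_mode_ok : forall i, mode_ok (env G) (intra_mode G i);
  inter_mode_ok : mode_ok (env G) (inter_mode G);
  weight_ge0 : forall i, 0 <= weight G i;
  weight_le1 : forall i, weight G i <= 1;
  intra_fraction_gt0 : forall i, 0 < intra_fraction G i;
  intra_fraction_le1 : forall i, intra_fraction G i <= 1;
  inter_fraction_ge0 : 0 <= inter_fraction G;
  inter_fraction_le1 : inter_fraction G <= 1;
  cell_target_gt0 : forall i, 0 < cell_target G i;
  intra_target_gt0 : forall i, 0 < intra_target G i;
  overlay_cell_band_gt0 : forall i, scheme G i = Overlay ->
    0 < overlay_cell_band G i;
  overlay_cell_rate : forall i, scheme G i = Overlay ->
    band_rate (env G) (cell_mode G i) (overlay_cell_band G i)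
    = cell_target G i;
  min_contribution_gt0 : forall i, 0 < min_contribution G i;
  min_le_max_contribution : forall i,
    min_contribution G i <= max_contribution G i;
  max_contribution_feasible : forall i, feasible G i (max_contribution G i);
  max_contribution_max : forall i (x : R),
    feasible G i x -> x <= max_contribution G i
}.

Definition strategies (R : realType) (d : measure_display)
    (T : measurableType d) (P : probability T R) (N : nat) (G : game P N)
    (i : 'I_N) : set R :=
  `[min_contribution G i, max_contribution G i].

Definition is_profile (R : realType) (d : measure_display)
    (T : measurableType d) (P : probability T R) (N : nat) (G : game P N)
    (beta : 'I_N -> R) : Prop :=
  forall i, strategies G i (beta i).

Definition deviate (R : realType) (N : nat) (beta : 'I_N -> R) (i : 'I_N)
    (x : R) : 'I_N -> R :=
  [eta beta with i |-> x].

Definition nash (R : realType) (d : measure_display)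
    (T : measurableType d) (P : probability T R) (N : nat) (G : game P N)
    (beta : 'I_N -> R) : Prop :=
  is_profile G beta /\
  forall i x, strategies G i x ->
    utility G i (deviate beta i x) <= utility G i beta.

Definition concave_function (R : realType) (D : set R) (f : R -> R) : Prop :=
  @convex_function R R^o D (fun x => - f x).

Definition concave_utility (R : realType) (d : measure_display)
    (T : measurableType d) (P : probability T R) (N : nat) (G : game P N)
    (i : 'I_N) : Prop :=
  forall beta : 'I_N -> R, is_profile G beta ->
    concave_function (strategies G i) (fun x => utility G i (deviate beta i x)).

(* Main.v *)
Require Import Defs.
From mathcomp Require Import all_boot all_order all_algebra.
From mathcomp Require Import all_classical all_reals all_analysis measurable_realfun.
From mathcomp Require Import ring lra.

(** Each band rate [F(b)] (bandwidth times spectral efficiency) is an average of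
functions [b |-> \int b e^(- b c z) psi(z) dz] with [psi] decreasing, hence is strictly
concave on [0, +oo) and vanishes at [0]. Since moreover [F(b) / b] is convex and
nonincreasing, [F] has a locally Lipschitz derivative. The utility of an operator
is therefore [A_i(x_i) + W_i(B)], where [B] is the pool, [A_i] is concave
(strictly unless the weight is 1) and [W_i] is concave and differentiable. A profile is
an equilibrium iff each [x_i] maximizes [A_i(x) + W_i'(B) x]; this maximizer
[r_i(B)] is unique, continuous and nonincreasing in [B], so
[\sum_i r_i(B) = B] has exactly one solution. *)

Set Implicit Arguments.
Unset Strict Implicit.
Unset Printing Implicit Defensive.

Import Order.TTheory GRing.Theory Num.Theory.
Import numFieldNormedType.Exports.

Local Open Scope classical_set_scope.
Local Open Scope ring_scope.

(** * Exponential kernels against decreasing weights *)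

(** For fixed z > 0 the kernel b e^(- b c z) is concave in b only while b c z <= 2, so concavity of
    F cannot be checked under the integral sign. What saves it is that the kernel has the same total
    mass 1/c over z for every b > 0: as a function of z, its Jensen gap has a nonnegative integral
    and at most one sign change, from positive to negative, and a decreasing psi favours the
    positive part. No derivative is taken under the integral either. Dividing by b leaves the kernel
    e^(- b c z), convex and decreasing in b, which bounds F from the convex side and yields
    two-sided quadratic estimates. They are needed because a deviation also moves B: replacing W_i
    by its linear part at B requires differentiability there. The splitting into A_i and W_i rests
    on q = 1, which removes the cellular term from the inter-operator rate. At weight 1, A_i
    vanishes and uniqueness of r_i(B) comes from W_i' > 0 instead. *)

Lemma Rintegral_gt0 d (T : measurableType d) (R : realType)
    (mu : {measure set T -> \bar R}) (D : set T) (f : T -> R) :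
  measurable D -> mu.-integrable D (EFin \o f) -> (forall x, D x -> 0 <= f x) ->
  ~ ae_eq mu D (EFin \o f) (cst 0%E) -> 0 < \int[mu]_(x in D) f x.
Proof.
move=> mD fi f0 fae; rewrite lt_neqAle Rintegral_ge0// andbT.
apply/negP => /eqP If; apply: fae; apply/(ae_eq_integral_abs mu mD).
  exact: measurable_int fi.
under eq_integral => x /[1!inE] Dx do rewrite gee0_abs ?lee_fin ?f0//.
have := integrable_fin_num mD fi; rewrite /Rintegral in If.
by move=> /fineK <-; rewrite -If.
Qed.

(** Three terms are what a Jensen inequality involves: the two endpoints and the intermediate point.
    Two-term uses take a zero coefficient. *)
Lemma Rintegral_lincomb3 d (T : measurableType d) (R : realType)
    (mu : {measure set T -> \bar R}) (D : set T) (f1 f2 f3 : T -> R) (k1 k2 k3 : R) :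
  measurable D -> mu.-integrable D (EFin \o f1) -> mu.-integrable D (EFin \o f2) ->
  mu.-integrable D (EFin \o f3) ->
  mu.-integrable D (EFin \o fun x => k1 * f1 x + k2 * f2 x + k3 * f3 x) /\
  \int[mu]_(x in D) (k1 * f1 x + k2 * f2 x + k3 * f3 x) =
    k1 * \int[mu]_(x in D) f1 x + k2 * \int[mu]_(x in D) f2 x +
    k3 * \int[mu]_(x in D) f3 x.
Proof.
move=> mD i1 i2 i3.
have iZ k f : mu.-integrable D (EFin \o f) -> mu.-integrable D (EFin \o fun x => k * f x).
  exact: integrableZl.
have i12 := integrableD mD (iZ k1 _ i1) (iZ k2 _ i2).
split; first exact: (integrableD mD i12 (iZ k3 _ i3)).
rewrite (RintegralD mD i12 (iZ k3 _ i3)) (RintegralD mD (iZ k1 _ i1) (iZ k2 _ i2)).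
by rewrite (RintegralZl k1 mD i1) (RintegralZl k2 mD i2) (RintegralZl k3 mD i3).
Qed.

Lemma Rintegral_lincomb3_ge0 d (T : measurableType d) (R : realType)
    (mu : {measure set T -> \bar R}) (D : set T) (f1 f2 f3 : T -> R) (k1 k2 k3 : R) :
  measurable D -> mu.-integrable D (EFin \o f1) -> mu.-integrable D (EFin \o f2) ->
  mu.-integrable D (EFin \o f3) ->
  (forall x, D x -> 0 <= k1 * f1 x + k2 * f2 x + k3 * f3 x) ->
  0 <= k1 * \int[mu]_(x in D) f1 x + k2 * \int[mu]_(x in D) f2 x +
    k3 * \int[mu]_(x in D) f3 x.
Proof.
by move=> mD i1 i2 i3 h; have [_ <-] := Rintegral_lincomb3 k1 k2 k3 mD i1 i2 i3;
  exact: Rintegral_ge0.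
Qed.

Section exponential_kernel.
Variable R : realType.
Implicit Types b c t y z : R.

Definition expdens b z : R := b * expR (- (b * z)).

Lemma expdens_ge0 b z : 0 <= b -> 0 <= expdens b z.
Proof. by move=> b0; rewrite mulr_ge0// expR_ge0. Qed.

(** Convexity of the exponential between 0 and y, from the tangent at s * y evaluated at y and at 0,
    averaged with weights s and 1 - s. *)
Lemma expR_le_chord s y : 0 <= s <= 1 -> expR (s * y) <= s * expR y + (1 - s).
Proof.
move=> /andP[s0 s1].
have e0 : 0 < expR (s * y) := expR_gt0 _.
have h1 : expR (s * y) * (1 + (1 - s) * y) <= expR y.
  have -> : expR y = expR (s * y) * expR ((1 - s) * y).
    by rewrite -expRD; congr expR; ring.
  by rewrite ler_wpM2l// ?expR_ge1Dx// ltW.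
have h2 : expR (s * y) * (1 - s * y) <= 1.
  have : expR (s * y) * (1 + - (s * y)) <= expR (s * y) * expR (- (s * y)).
    by rewrite ler_wpM2l// ?expR_ge1Dx// ltW.
  by rewrite expRxMexpNx_1.
have {}h1 : s * (expR (s * y) * (1 + (1 - s) * y)) <= s * expR y.
  by rewrite ler_wpM2l.
have {}h2 : (1 - s) * (expR (s * y) * (1 - s * y)) <= (1 - s) * 1.
  by rewrite ler_wpM2l// subr_ge0.
by lra.
Qed.

(** * Sign pattern of the Jensen gap of the kernel *)

Section concavity_defect.
Variables b1 b2 t : R.
Hypotheses (b1_ge0 : 0 <= b1) (b12 : b1 < b2) (t01 : 0 < t < 1).

Let b := t * b1 + (1 - t) * b2.

Definition defect z :=
  expdens b z - t * expdens b1 z - (1 - t) * expdens b2 z.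

Let b1b : b1 < b.
Proof.
have /andP[t0 t1] := t01.
rewrite -subr_gt0 (_ : b - b1 = (1 - t) * (b2 - b1)); last by rewrite /b; ring.
by rewrite mulr_gt0// subr_gt0.
Qed.

Let bb2 : b < b2.
Proof.
have /andP[t0 t1] := t01.
rewrite -subr_gt0 (_ : b2 - b = t * (b2 - b1)); last by rewrite /b; ring.
by rewrite mulr_gt0// subr_gt0.
Qed.

Let t'_ge0 : 0 <= 1 - t.
Proof. by have /andP[_ t1] := t01; rewrite subr_ge0 ltW. Qed.

Let b2_ge0 : 0 <= b2.
Proof. exact: le_trans b1_ge0 (ltW b12). Qed.

(** The gap divided by the positive factor expR (- (b * z)). It has the same sign, is concave in z
    and vanishes at z = 0. *)
Let q z := b - t * b1 * expR ((b - b1) * z) - (1 - t) * b2 * expR ((b - b2) * z).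

Let defectE z : defect z = expR (- (b * z)) * q z.
Proof.
have shift x : expR (- (x * z)) = expR (- (b * z)) * expR ((b - x) * z).
  by rewrite -expRD; congr expR; ring.
by rewrite /defect /expdens /q (shift b1) (shift b2); ring.
Qed.

(** Bounding both exponentials by expR y <= (1 - y)^-1 turns [q z] into a rational function whose
    numerator contains the factor 1 - z * b, hence the threshold. *)
Lemma defect_gt0 z : 0 < z -> z * b < 1 -> 0 < defect z.
Proof.
move=> z0 zb; rewrite defectE mulr_gt0 ?expR_gt0//.
have /andP[t0 t1] := t01.
have e y : y < 1 -> expR y <= (1 - y)^-1.
  move=> y1; rewrite -[y in expR y]opprK expRN lef_pV2 ?posrE ?expR_gt0//.
    by rewrite -[1 - y]/(1 + - y) expR_ge1Dx.
  by rewrite subr_gt0.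
have p0 : 0 < 1 - (b - b1) * z.
  have : 0 <= b1 * z by rewrite mulr_ge0// ltW.
  by rewrite mulrBl; lra.
have r0 : 0 < 1 - (b - b2) * z.
  have : 0 < (b2 - b) * z by rewrite mulr_gt0// subr_gt0.
  by rewrite !mulrBl; lra.
have e1 := e ((b - b1) * z) ltac:(by rewrite -subr_gt0).
have e2 := e ((b - b2) * z) ltac:(by rewrite -subr_gt0).
have {}e1 : t * b1 * expR ((b - b1) * z) <= t * b1 * (1 - (b - b1) * z)^-1.
  by rewrite ler_wpM2l// mulr_ge0// ltW.
have {}e2 : (1 - t) * b2 * expR ((b - b2) * z) <= (1 - t) * b2 * (1 - (b - b2) * z)^-1.
  by rewrite ler_wpM2l// mulr_ge0.
suff : t * b1 * (1 - (b - b1) * z)^-1 + (1 - t) * b2 * (1 - (b - b2) * z)^-1 < b.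
  by rewrite /q; lra.
rewrite -subr_gt0.
have -> : b - (t * b1 * (1 - (b - b1) * z)^-1 + (1 - t) * b2 * (1 - (b - b2) * z)^-1)
  = (b - b1) * (b2 - b) * z * (1 - z * b)
     * ((1 - (b - b1) * z)^-1 * (1 - (b - b2) * z)^-1).
  move: p0 r0; rewrite /b => p0 r0; field.
  by rewrite !gt_eqF.
have [? ?] : 0 < b - b1 /\ 0 < b2 - b by rewrite !subr_gt0.
have ? : 0 < 1 - z * b by rewrite subr_gt0.
by do ![apply: mulr_gt0]; rewrite ?invr_gt0.
Qed.

(** A concave function vanishing at 0 and nonnegative at y is nonnegative in between; here the
    concavity of [q] is the chord bound on each exponential, whose coefficient is nonpositive. *)
Lemma defect_ge0_le z y : 0 <= z -> z <= y -> 0 <= defect y -> 0 <= defect z.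
Proof.
move=> z0 zy.
rewrite !defectE !pmulr_rge0 ?expR_gt0// => qy.
have [->|zn0] := eqVneq z 0.
  by rewrite /q !mulr0 expR0; rewrite /b; lra.
have y0 : 0 < y by rewrite (lt_le_trans _ zy)// lt_neqAle eq_sym zn0.
pose s := z / y.
have s01 : 0 <= s <= 1 by rewrite /s ler_pdivrMr// mul1r zy andbT divr_ge0// ltW.
have zE : z = s * y by rewrite /s divfK// gt_eqF.
have /andP[t0 t1] := t01.
have h1 := expR_le_chord ((b - b1) * y) s01.
have h2 := expR_le_chord ((b - b2) * y) s01.
have {}h1 : t * b1 * expR (s * ((b - b1) * y)) <= t * b1 * (s * expR ((b - b1) * y) + (1 - s)).
  by rewrite ler_wpM2l// mulr_ge0// ltW.
have {}h2 : (1 - t) * b2 * expR (s * ((b - b2) * y)) <=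
    (1 - t) * b2 * (s * expR ((b - b2) * y) + (1 - s)).
  by rewrite ler_wpM2l// mulr_ge0.
have {qy} : 0 <= s * q y by rewrite mulr_ge0//; case/andP: s01.
rewrite /q zE [(b - b1) * (s * y)]mulrCA [(b - b2) * (s * y)]mulrCA.
have : b = t * b1 + (1 - t) * b2 by [].
by move: h1 h2; nra.
Qed.

End concavity_defect.

Notation mu := (@lebesgue_measure R).

Lemma measurable_expdens b c (D : set R) : measurable_fun D (fun z => expdens b (c * z)).
Proof.
apply: measurable_funM => //; apply: measurableT_comp => //.
by apply: measurableT_comp => //; do 2 apply: measurable_funM => //.
Qed.

(** The integrand is c^-1 times the exponential density of rate b * c. That the value does not
    depend on b is the fact behind the concavity of the band rates. *)
Lemma integral_expdens b c : 0 < b -> 0 < c ->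
  (\int[mu]_(z in `[0%R, +oo[) (expdens b (c * z))%:E = (c^-1)%:E)%E.
Proof.
move=> b0 c0; have bc : 0 < b * c by rewrite mulr_gt0.
rewrite integral_mkcond.
transitivity (\int[mu]_z ((c^-1)%:E * (exponential_pdf (b * c) z)%:E))%E.
  apply: eq_integral => z _; rewrite /exponential_pdf !patchE.
  case: ifPn => _; last by rewrite mule0.
  by rewrite -EFinM /expdens (_ : - (b * c) * z = - (b * (c * z)));
    [congr (_%:E); field; rewrite gt_eqF|ring].
rewrite integralZl//; last exact: integrable_exponential_pdf.
by rewrite integral_exponential_pdf// mule1.
Qed.

Lemma integrable_expdens b c : 0 <= b -> 0 < c ->
  mu.-integrable `[0, +oo[ (fun z => (expdens b (c * z))%:E).
Proof.
rewrite le_eqVlt => /predU1P[<- _|b0 c0].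
  apply: eq_integrable (integrable0 _ _) => // z _.
  by rewrite /expdens mul0r.
apply/integrableP; split.
  by apply/measurable_EFinP; exact: measurable_expdens.
under eq_integral do rewrite gee0_abs ?lee_fin ?expdens_ge0 ?(ltW b0)//.
by rewrite integral_expdens// ltry.
Qed.

Lemma Rintegral_expdens_le b c : 0 <= b -> 0 < c ->
  \int[mu]_(z in `[0, +oo[) expdens b (c * z) <= c^-1.
Proof.
move=> b0 c0; move: b0; rewrite le_eqVlt => /predU1P[<-|b0]; last first.
  by rewrite /Rintegral integral_expdens.
rewrite (@eq_Rintegral _ _ _ _ _ (cst 0)) ?Rintegral_cst// ?mul0r ?invr_ge0 ?ltW//.
by move=> z _; rewrite /expdens mul0r.
Qed.

(** The masses at b and b2 are both c^-1, and so is the one at b1 unless b1 = 0, where it is 0. The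
    integral is therefore 0 or t / c. *)
Lemma Rintegral_defect_ge0 b1 b2 t c : 0 <= b1 -> b1 < b2 -> 0 < t < 1 -> 0 < c ->
  0 <= \int[mu]_(z in `[0, +oo[) defect b1 b2 t (c * z).
Proof.
move=> b10 b12 /andP[t0 t1] c0.
have b20 : 0 < b2 := le_lt_trans b10 b12.
have I b : 0 < b -> \int[mu]_(z in `[0, +oo[) expdens b (c * z) = c^-1.
  by move=> b0; rewrite /Rintegral integral_expdens.
have b0 : 0 < t * b1 + (1 - t) * b2.
  by rewrite ltr_wpDl ?mulr_ge0 ?mulr_gt0 ?subr_gt0// ltW.
have ib b' : 0 <= b' -> mu.-integrable `[0, +oo[ (EFin \o fun z => expdens b' (c * z)).
  by move=> ?; exact: integrable_expdens.
have iZ b' k : 0 <= b' ->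
    mu.-integrable `[0, +oo[ (EFin \o fun z => k * expdens b' (c * z)).
  by move=> ?; apply: (integrableZl _ k (ib b' _)).
rewrite RintegralB//; last 2 first.
- apply: (integrableB _ (ib _ (ltW b0)) (iZ _ t _)) => //.
- exact/iZ/ltW.
rewrite RintegralB//; [|exact/ib/ltW|exact: iZ].
have b20' := ltW b20.
rewrite (RintegralZl t _ (ib _ b10))// (RintegralZl (1 - t) _ (ib _ b20'))//.
rewrite (I _ b0) (I _ b20); suff : \int[mu]_(z in `[0, +oo[) expdens b1 (c * z) <= c^-1.
  have : 0 < c^-1 by rewrite invr_gt0.
  by nra.
exact: Rintegral_expdens_le.
Qed.

(** * Kernel masses against a decreasing weight *)

Section decreasing_weight.
Variables (c : R) (psi : R -> R).
Hypothesis c_gt0 : 0 < c.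
Hypothesis mpsi : measurable_fun (`[0, +oo[ : set R) psi.
Hypothesis psi_ge0 : forall z, 0 <= z -> 0 <= psi z.
Hypothesis psi_le1 : forall z, 0 <= z -> psi z <= 1.
Hypothesis psi_decr : forall z y, 0 <= z -> z < y -> psi y < psi z.

Lemma integrable_expdens_weight b : 0 <= b ->
  mu.-integrable `[0, +oo[ (fun z => (expdens b (c * z) * psi z)%:E).
Proof.
move=> b0; apply: le_integrable (integrable_expdens b0 c_gt0) => //.
  apply/measurable_EFinP; apply: measurable_funM => //.
  exact: measurable_expdens.
move=> z; rewrite /= in_itv/= andbT => z0.
rewrite lee_fin !ger0_norm ?mulr_ge0 ?expdens_ge0 ?psi_ge0//.
by rewrite ler_piMr ?expdens_ge0 ?psi_le1.
Qed.

Definition weighted_mass b := \int[mu]_(z in `[0, +oo[) (expdens b (c * z) * psi z).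

(* The defect is first nonnegative, then negative, and its integral is
   nonnegative; so its integral against a decreasing weight is positive. *)
Lemma weighted_mass_strictly_concave b1 b2 t : 0 <= b1 -> b1 < b2 -> 0 < t < 1 ->
  t * weighted_mass b1 + (1 - t) * weighted_mass b2 <
    weighted_mass (t * b1 + (1 - t) * b2).
Proof.
move=> b10 b12 t01; have /andP[t0 t1] := t01.
have b20 : 0 < b2 := le_lt_trans b10 b12.
pose D z := defect b1 b2 t (c * z).
pose b := t * b1 + (1 - t) * b2.
have b0 : 0 < b by rewrite ltr_wpDl ?mulr_ge0 ?mulr_gt0 ?subr_gt0// ltW.
(* The infimum [p] of the weight over the points with nonnegative gap separates the two sign regions
   without naming a crossing point: [psi z - p] and [D z] never have opposite signs. *)
pose A := [set psi z | z in [set z | 0 <= z /\ 0 <= D z]].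
pose p := inf A.
(* Chosen so that c * z1 * b = 1/2, below the threshold 1 up to which the gap is known to be
   positive. *)
pose z1 := (2 * b * c)^-1.
have z10 : 0 < z1 by rewrite invr_gt0 !mulr_gt0.
have Dpos z : 0 < z -> z <= z1 -> 0 < D z.
  move=> z0 zz1; apply: defect_gt0; rewrite ?mulr_gt0//.
  rewrite -/b; have : c * z * b <= c * z1 * b.
    by rewrite ler_wpM2r ?ler_wpM2l// ltW.
  suff : c * z1 * b = 2^-1 by lra.
  by rewrite /z1; field; rewrite !gt_eqF.
have A0 : A !=set0.
  by exists (psi z1), z1 => //=; rewrite !ltW// Dpos.
have lA : has_lbound A by exists 0 => _ [z [z0 _] <-]; exact: psi_ge0.
have p0 : 0 <= p by apply: lb_le_inf => // _ [z [z0 _] <-]; exact: psi_ge0.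
have cmp z : 0 <= z -> 0 <= (psi z - p) * D z.
  move=> z0; have [Dz|Dz] := leP 0 (D z).
    by rewrite mulr_ge0// subr_ge0; apply: ge_inf => //; exists z.
  (* Where the gap is negative, every point with nonnegative gap lies strictly to the left, so
     [psi z] is a lower bound of [A]. *)
  apply: mulr_le0; last exact: ltW.
  rewrite subr_le0; apply: lb_le_inf => // _ [y [y0 Dy] <-].
  rewrite ltW// psi_decr// ltNge; apply/negP => zy; move: Dz; apply/negP.
  rewrite -leNgt; apply: (@defect_ge0_le b1 b2 t b10 b12 t01 _ (c * y)) => //.
    by rewrite mulr_ge0// ltW.
  by rewrite ler_wpM2l// ltW.
have mD : measurable (`[0, +oo[ : set (measurableTypeR R)) by [].
have iw b' : 0 <= b' ->
    mu.-integrable `[0, +oo[ (EFin \o fun z => expdens b' (c * z) * psi z).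
  by move=> ?; exact: integrable_expdens_weight.
have iwZ b' k : 0 <= b' -> mu.-integrable `[0, +oo[
    (EFin \o fun z => k * (expdens b' (c * z) * psi z)).
  by move=> ?; apply: (integrableZl _ k (iw b' _)).
have ie b' k : 0 <= b' ->
    mu.-integrable `[0, +oo[ (EFin \o fun z => k * expdens b' (c * z)).
  by move=> ?; apply: (integrableZl _ k (integrable_expdens _ c_gt0)).
have iD : mu.-integrable `[0, +oo[ (EFin \o D).
  have i1 : mu.-integrable `[0, +oo[ (EFin \o fun z => expdens b (c * z)).
    exact: (integrable_expdens (ltW b0) c_gt0).
  exact: (integrableB _ (integrableB _ i1 (ie b1 t b10)) (ie b2 (1 - t) (ltW b20))).
have iDw : mu.-integrable `[0, +oo[ (EFin \o fun z => D z * psi z).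
  have := (integrableB mD (integrableB mD (iw b (ltW b0)) (iwZ b1 t b10))
    (iwZ b2 (1 - t) (ltW b20))).
  apply: eq_integrable => // z _.
  by rewrite /= -!EFinB /D /defect; congr (_%:E); ring.
have ipD : mu.-integrable `[0, +oo[ (EFin \o fun z => p * D z).
  exact: (integrableZl _ p iD).
have E : \int[mu]_(z in `[0, +oo[) ((psi z - p) * D z) =
    weighted_mass b - t * weighted_mass b1 - (1 - t) * weighted_mass b2
     - p * \int[mu]_(z in `[0, +oo[) D z.
  transitivity (\int[mu]_(z in `[0, +oo[) (D z * psi z - p * D z)).
    by apply: eq_Rintegral => z _; ring.
  rewrite RintegralB// RintegralZl//; congr (_ - _).
  rewrite /weighted_mass -(RintegralZl t mD (iw _ b10)).
  rewrite -(RintegralZl (1 - t) mD (iw _ (ltW b20))).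
  rewrite -(RintegralB mD (iw _ (ltW b0)) (iwZ _ t b10)).
  rewrite -RintegralB//; last 2 first.
  - exact: (integrableB mD (iw b (ltW b0)) (iwZ b1 t b10)).
  - exact: (iwZ b2 (1 - t) (ltW b20)).
  by apply: eq_Rintegral => z _; rewrite /D /defect -/b; ring.
(* Centring the weight at [p] subtracts p times the integral of the gap, which is nonnegative. *)
suff : 0 < \int[mu]_(z in `[0, +oo[) ((psi z - p) * D z).
  have : 0 <= p * \int[mu]_(z in `[0, +oo[) D z.
    by rewrite mulr_ge0// Rintegral_defect_ge0.
  rewrite E -/b; move: (weighted_mass b) (p * _) => x y.
  move: (t * _) ((1 - t) * _) => u v y0 uvy.
  by rewrite -subr_gt0 opprD addrA (lt_le_trans uvy)// gerBl.
apply: Rintegral_gt0 => //.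
- apply: eq_integrable (integrableB mD iDw ipD) => // z _.
  by rewrite /= -EFinB; congr (_%:E); ring.
- by move=> z /=; rewrite in_itv/= andbT; exact: cmp.
(* Strictness: on ]0, z1[ the gap is positive and psi z > psi z1 >= p, so a product vanishing almost
   everywhere would make this interval null. *)
move=> /(ae_eq_subset _); have sub : `]0, z1[ `<=` (`[0, +oo[ : set R).
  by move=> z /=; rewrite !in_itv/= andbT => /andP[/ltW].
move=> /(_ _ sub) ae.
have : mu `]0, z1[ = 0%E.
  case: ae => N [mN N0 sN].
  apply/eqP; rewrite -measure_le0 -N0 le_measure ?inE//.
  move=> z zz; apply: sN => /(_ zz) /=.
  move: zz; rewrite /= in_itv/= => /andP[z0 zz1] [/eqP].
  rewrite mulf_eq0 [D z == 0]gt_eqF ?Dpos// ?(ltW zz1)// orbF subr_eq0 => /eqP psip.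
  have : psi z1 < psi z by rewrite psi_decr// ltW.
  rewrite psip; apply/negP; rewrite -leNgt; apply: ge_inf => //.
  by exists z1 => //=; rewrite !ltW// Dpos.
by rewrite lebesgue_measure_itv/= lte_fin z10 oppr0 adde0 => -[]/eqP; rewrite gt_eqF.
Qed.

Let mD : measurable (`[0, +oo[ : set (measurableTypeR R)).
Proof. exact: measurable_itv. Qed.

Let iw b : 0 <= b -> mu.-integrable `[0, +oo[
  (EFin \o fun z => expdens b (c * z) * psi z).
Proof. exact: integrable_expdens_weight. Qed.

Lemma weighted_mass_ge0 b : 0 <= b -> 0 <= weighted_mass b.
Proof.
move=> b0; apply: Rintegral_ge0 => z; rewrite /= in_itv/= andbT => z0.
by rewrite mulr_ge0 ?expdens_ge0 ?psi_ge0.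
Qed.

Lemma weighted_mass_lincomb_ge0 b1 b2 b3 k1 k2 k3 :
  0 <= b1 -> 0 <= b2 -> 0 <= b3 ->
  (forall z, 0 <= z -> 0 <= k1 * expdens b1 z + k2 * expdens b2 z + k3 * expdens b3 z) ->
  0 <= k1 * weighted_mass b1 + k2 * weighted_mass b2 + k3 * weighted_mass b3.
Proof.
move=> /iw i1 /iw i2 /iw i3 h.
apply: (Rintegral_lincomb3_ge0 mD i1 i2 i3) => z; rewrite /= in_itv/= andbT => z0.
have := h (c * z); rewrite mulr_ge0 ?(ltW c_gt0)// => /(_ isT) hz.
have := mulr_ge0 hz (psi_ge0 z0); rewrite !mulrDl -!mulrA; exact.
Qed.

(** Divided by b, the kernel becomes expR (- (b * z)), which is nonincreasing in b for each z >=
    0. *)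
Lemma weighted_mass_div_nonincr b y : 0 < b -> b <= y ->
  weighted_mass y / y <= weighted_mass b / b.
Proof.
move=> b0 by_; have y0 := lt_le_trans b0 by_.
have := @weighted_mass_lincomb_ge0 b y 0 b^-1 (- y^-1) 0 (ltW b0) (ltW y0) (lexx 0).
rewrite mul0r addr0 mulNr subr_ge0 ![_^-1 * _]mulrC; apply => z z0.
rewrite /expdens mul0r addr0 mulNr subr_ge0 !mulKf ?gt_eqF//.
by rewrite ler_expR lerN2 ler_wpM2r.
Qed.

(** The kernel divided by b is convex in b: once expR (- (b2 * z)) is factored out, this is the
    chord bound for the exponential. *)
Lemma weighted_mass_div_convex b1 b2 t : 0 < b1 -> 0 < b2 -> 0 <= t <= 1 ->
  weighted_mass (t * b1 + (1 - t) * b2) / (t * b1 + (1 - t) * b2) <=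
    t * (weighted_mass b1 / b1) + (1 - t) * (weighted_mass b2 / b2).
Proof.
move=> b10 b20 t01; set b := t * b1 + _; have /andP[t0 t1] := t01.
have b0 : 0 < b.
  move: t0; rewrite le_eqVlt => /predU1P[t0|t0]; first by rewrite /b -t0 mul0r add0r subr0 mul1r.
  by rewrite ltr_pwDl ?mulr_gt0// mulr_ge0 ?subr_ge0// ltW.
have := @weighted_mass_lincomb_ge0 b1 b2 b (t / b1) ((1 - t) / b2) (- b^-1)
  (ltW b10) (ltW b20) (ltW b0).
rewrite mulNr subr_ge0 [b^-1 * _]mulrC -[t / _ * _]mulrA [b1^-1 * _]mulrC.
rewrite -[_ / b2 * _]mulrA [b2^-1 * _]mulrC; apply => z z0.
rewrite mulNr subr_ge0 -![_ / _ * _]mulrA !mulKf ?gt_eqF//.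
have -> : - (b * z) = t * ((b2 - b1) * z) + - (b2 * z) by rewrite /b; ring.
have -> : - (b1 * z) = (b2 - b1) * z + - (b2 * z) by ring.
rewrite !expRD [X in _ <= X + _]mulrA -mulrDl ler_wpM2r ?expR_ge0//.
exact: expR_le_chord.
Qed.

(** Cut at [a]: before it the integrand is at most b, after it psi <= psi a and the kernel has mass
    at most c^-1. Taking [a] large and then b small will show that the mass tends to 0 with b. *)
Lemma weighted_mass_le a b : 0 <= a -> 0 <= b -> weighted_mass b <= a * b + psi a / c.
Proof.
move=> a0 b0.
have ii : mu.-integrable `[0, +oo[ (EFin \o \1_(`[0, a] : set (measurableTypeR R))).
  exact: (integrableS measurableT mD (@subsetT _ _) (integrable_indic_itv 0 a true false)).
have ie := integrable_expdens b0 c_gt0.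
have [i E] := Rintegral_lincomb3 b (psi a) 0 mD ii ie ie.
have I1 : \int[mu]_(z in `[0, +oo[) \1_(`[0, a] : set (measurableTypeR R)) z = a.
  rewrite /Rintegral integral_indic//=.
  rewrite (_ : _ `&` _ = `[0, a]%classic); last first.
    apply/seteqP; split=> z /=; rewrite !in_itv/= andbT; first by case.
    by move=> /andP[-> ->].
  rewrite lebesgue_measure_itv/= lte_fin oppr0 adde0.
  by move: a0; rewrite le_eqVlt => /predU1P[<-|->//]; rewrite ltxx.
apply: (@le_trans _ _ (b * a + psi a * \int[mu]_(z in `[0, +oo[) expdens b (c * z))).
  have -> : b * a + psi a * \int[mu]_(z in `[0, +oo[) expdens b (c * z) =
      \int[mu]_(z in `[0, +oo[) (b * \1_(`[0, a] : set R) z +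
         psi a * expdens b (c * z) + 0 * expdens b (c * z)).
    by rewrite E I1 mul0r addr0.
  apply: le_Rintegral => //; first exact: iw.
  move=> z; rewrite /= in_itv/= andbT => z0.
  have e0 := expdens_ge0 (c * z) b0.
  rewrite mul0r addr0 indicE mem_setE in_itv/= z0/=.
  have [za|az] := leP z a.
    rewrite mulr1 -[leLHS]addr0 lerD ?mulr_ge0 ?psi_ge0//.
    apply: (@le_trans _ _ (b * 1)); last by rewrite mulr1.
    rewrite -mulrA ler_wpM2l// mulr_ile1 ?expR_ge0 ?psi_ge0 ?psi_le1//.
    by rewrite expR_le1 oppr_le0 !mulr_ge0// ltW.
  by rewrite mulr0 add0r mulrC ler_wpM2r// ltW// psi_decr.
rewrite mulrC lerD2l ler_wpM2l ?psi_ge0//.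
exact: Rintegral_expdens_le.
Qed.

End decreasing_weight.
End exponential_kernel.

(** * Strictly concave functions on the half-line *)

Section concave_ray.
Variable R : realType.
Implicit Types (F W lam : R -> R) (b y t : R).

Definition strictly_concave_ray F := forall b1 b2 t,
  0 <= b1 -> b1 < b2 -> 0 < t < 1 ->
  t * F b1 + (1 - t) * F b2 < F (t * b1 + (1 - t) * b2).

(** Equivalently, F b + C * b ^+ 2 is convex on [b0, +oo): the last term is C times the Jensen gap
    of the square. *)
Definition semiconvex F := forall b0, 0 < b0 -> exists2 C, 0 <= C &
  forall b1 b2 t, b0 <= b1 -> b0 <= b2 -> 0 <= t <= 1 ->
  F (t * b1 + (1 - t) * b2) <=
    t * F b1 + (1 - t) * F b2 + C * (t * (1 - t) * (b1 - b2) ^+ 2).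

(* A quantitative form of "[W] is concave on (0, +oo) with derivative [lam]". *)
Definition smooth_slope W lam :=
  (forall b y, 0 < b -> 0 < y -> W y <= W b + lam b * (y - b)) /\
  (forall b0, 0 < b0 -> exists2 C, 0 <= C & forall b y, b0 <= b -> b0 <= y ->
     W b + lam b * (y - b) - C * (y - b) ^+ 2 <= W y).

Lemma concave_ray_slope F b y z : strictly_concave_ray F ->
  0 <= b -> b < y -> y < z ->
  (F z - F y) * (y - b) < (F y - F b) * (z - y).
Proof.
move=> Fc b0 by_ yz; have bz := lt_trans by_ yz.
have zb : 0 < z - b by rewrite subr_gt0.
pose t := (z - y) / (z - b).
have t01 : 0 < t < 1.
  by rewrite divr_gt0 ?subr_gt0// ltr_pdivrMr// mul1r ltrD2l ltrN2.
have := Fc _ _ _ b0 bz t01.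
have -> : t * b + (1 - t) * z = y by rewrite /t; field; rewrite gt_eqF.
rewrite -(ltr_pM2r zb).
have -> : (t * F b + (1 - t) * F z) * (z - b) = (z - y) * F b + (y - b) * F z.
  by rewrite /t; field; rewrite gt_eqF.
by lra.
Qed.


Lemma concave_ray_le F b1 b2 t : strictly_concave_ray F ->
  0 <= b1 -> 0 <= b2 -> 0 <= t <= 1 ->
  t * F b1 + (1 - t) * F b2 <= F (t * b1 + (1 - t) * b2).
Proof.
move=> Fc b10 b20 t01.
wlog b12 : b1 b2 t b10 b20 t01 / b1 <= b2.
  move=> hw; have /orP[|] := le_total b1 b2 => b12; first exact: hw.
  have t01' : 0 <= 1 - t <= 1 by lra.
  have := hw b2 b1 (1 - t) b20 b10 t01' b12.
  by rewrite subKr [leLHS]addrC [(1 - t) * b2 + _]addrC.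
have /andP[] := t01; rewrite le_eqVlt => /predU1P[<- _|t0].
  by rewrite !mul0r !add0r !subr0 !mul1r.
rewrite le_eqVlt => /predU1P[->|t1]; first by rewrite subrr !mul0r !addr0 !mul1r.
move: b12; rewrite le_eqVlt => /predU1P[->|b12].
  by rewrite -!mulrDl !subrKC !mul1r.
by apply/ltW/Fc => //; rewrite t0.
Qed.

(** If F failed to increase from b to y, it would decrease strictly after y, at least linearly after
    y + 1, and finally become negative. *)
Lemma concave_ray_incr F b y : strictly_concave_ray F -> (forall b, 0 <= b -> 0 <= F b) ->
  0 <= b -> b < y -> F b < F y.
Proof.
move=> Fc F0 b0 by_; rewrite ltNge; apply/negP => Fyb.
have b1y : b < b + 1 * (y - b) by lra.
have y0 : 0 < y by exact: le_lt_trans by_.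
have Fs z : y < z -> F z < F y.
  move=> yz; have := concave_ray_slope Fc b0 by_ yz.
  have : (F y - F b) * (z - y) <= 0.
    by rewrite mulr_le0_ge0 ?subr_le0// subr_ge0 ltW.
  move=> /[swap] /lt_le_trans /[apply].
  by rewrite pmulr_llt0 ?subr_gt0// subr_lt0.
have y1 : y < y + 1 by lra.
pose k := F y - F (y + 1).
have k0 : 0 < k by rewrite subr_gt0 Fs.
(* At this point the line through the values at y and y + 1, of slope - k, has reached the value - k
   < 0, and F lies below it. *)
pose z := y + 1 + F (y + 1) / k + 1.
have Fy1 := F0 (y + 1) ltac:(lra).
have Fk : 0 <= F (y + 1) / k by rewrite divr_ge0// ltW.
have y1z : y + 1 < z by rewrite /z; lra.
have := concave_ray_slope Fc (ltW y0) y1 y1z.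
have := F0 z ltac:(lra).
rewrite [y + 1 - y]addrAC subrr add0r mulr1 (_ : _ - F y = - k); last by rewrite /k opprB.
have -> : z - (y + 1) = F (y + 1) / k + 1 by rewrite /z; ring.
rewrite mulrDr mulNr mulrCA divff ?gt_eqF//; lra.
Qed.

Lemma concave_ray_nondecr F b y : strictly_concave_ray F ->
  (forall b, 0 <= b -> 0 <= F b) -> 0 <= b -> b <= y -> F b <= F y.
Proof.
move=> Fc F0 b0; rewrite le_eqVlt => /predU1P[->//|by_].
exact/ltW/(concave_ray_incr Fc F0).
Qed.

Lemma concave_ray_gt0 F b : strictly_concave_ray F -> (forall b, 0 <= b -> 0 <= F b) ->
  0 < b -> 0 < F b.
Proof. by move=> Fc F0 b0; rewrite (le_lt_trans (F0 0 _)) ?concave_ray_incr. Qed.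

(** The slope is the right derivative, written as the supremum of the forward difference quotients;
    concavity bounds them by every backward slope. *)
Lemma smooth_slope_exists F : strictly_concave_ray F -> semiconvex F ->
  exists mu, smooth_slope F mu.
Proof.
move=> Fc Fs.
pose A b := [set (F (b + t) - F b) / t | t in [set t | 0 < t]].
have A0 b : A b !=set0 by exists ((F (b + 1) - F b) / 1), 1 => /=.
have ubA b y : 0 < b -> 0 < y -> y < b -> ubound (A b) ((F b - F y) / (b - y)).
  move=> b0 y0 yb _ [t /= t0 <-].
  have bt : b < b + t by rewrite ltrDl.
  have := concave_ray_slope Fc (ltW y0) yb bt.
  rewrite ler_pdivrMr// mulrAC ler_pdivlMr ?subr_gt0// => /ltW.
  by rewrite [b + t - b]addrAC subrr add0r.
have supA b : 0 < b -> has_sup (A b).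
  move=> b0; split; first exact: A0.
  by exists ((F b - F (b / 2)) / (b - b / 2)); apply: ubA => //; lra.
have memA b t : 0 < b -> 0 < t -> F (b + t) - F b <= sup (A b) * t.
  move=> b0 t0; rewrite -ler_pdivrMr//; apply: sup_ubound; last by exists t.
  exact: (supA _ b0).2.
exists (fun b => sup (A b)); split=> [b y b0 y0|b0 b00].
  have [yb|by_|->] := ltgtP y b; last by lra.
    have : sup (A b) <= (F b - F y) / (b - y) by apply: sup_le_ub => //; exact: ubA.
    by rewrite ler_pdivlMr ?subr_gt0//; lra.
  by have := memA b (y - b) b0; rewrite subrKC subr_gt0 => /(_ by_); lra.
have [C C0 HC] := Fs _ b00.
exists (2 * C); first by rewrite mulr_ge0.
move=> b y bb0 yb0; have b_gt0 := lt_le_trans b00 bb0.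
have [yb|by_|->] := ltgtP y b; last by lra.
(* Backward case: b is the midpoint of y and its reflection b + h. The gap (1/4) * C * (2 * h) ^+ 2
   = C * h ^+ 2, doubled, is the origin of the constant 2 * C. *)
- pose h := b - y; have h0 : 0 < h by rewrite subr_gt0.
  have := HC y (b + h) 2^-1 yb0 ltac:(lra) ltac:(lra).
  have -> : 2^-1 * y + (1 - 2^-1) * (b + h) = b by rewrite /h; field.
  have -> : (y - (b + h)) ^+ 2 = 4 * h ^+ 2 by rewrite /h; ring.
  have := memA b h b_gt0 h0.
  have -> : y - b = - h by rewrite opprB.
  by rewrite sqrrN; lra.
- pose h := y - b; have h0 : 0 < h by rewrite subr_gt0.
  suff : sup (A b) <= (F y - F b + C * h ^+ 2) / h.
    rewrite ler_pdivlMr// -/h.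
    have : 0 <= C * h ^+ 2 by rewrite mulr_ge0// sqr_ge0.
    by lra.
  apply: sup_le_ub => // _ [t /= t0 <-].
  rewrite ler_pdivrMr// mulrAC ler_pdivlMr//.
  (* Increments reaching beyond y are handled by concavity, shorter ones by semiconvexity between b
     and y. *)
  have [th|ht] := leP t h; last first.
    have bt : y < b + t by rewrite -ltrBlDl.
    have := concave_ray_slope Fc (ltW b_gt0) by_ bt.
    have : 0 <= C * h ^+ 2 * t by rewrite mulr_ge0 ?mulr_ge0 ?sqr_ge0// ltW.
    by rewrite /h; lra.
  have := HC b y (1 - t / h) bb0 yb0.
  have th1 : t / h <= 1 by rewrite ler_pdivrMr// mul1r.
  have th0 : 0 < t / h by rewrite divr_gt0.
  move=> /(_ ltac:(lra)).
  have -> : (1 - t / h) * b + (1 - (1 - t / h)) * y = b + t.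
    by rewrite /h; field; rewrite gt_eqF.
  have -> : (b - y) ^+ 2 = h ^+ 2 by rewrite /h; ring.
  rewrite -(ler_pM2r h0).
  have -> : ((1 - t / h) * F b + (1 - (1 - t / h)) * F y +
      C * ((1 - t / h) * (1 - (1 - t / h)) * h ^+ 2)) * h =
     (h - t) * F b + t * F y + C * t * h * (h - t).
    by field; rewrite gt_eqF.
  have : 0 <= C * t * h * t by rewrite !mulr_ge0// ltW.
  by lra.
Qed.

Lemma smooth_slope_nonincr W lam b y : smooth_slope W lam ->
  0 < b -> b <= y -> lam y <= lam b.
Proof.
move=> [Wl _] b0; rewrite le_eqVlt => /predU1P[->//|by_].
have y0 := lt_trans b0 by_.
have h1 := Wl _ _ b0 y0; have h2 := Wl _ _ y0 b0.
rewrite -(ler_pM2r (_ : 0 < y - b)) ?subr_gt0//; lra.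
Qed.

(** Adding the lower quadratic bounds based at x and at y gives (lam x - lam y) * (y - x) <= 2 * C *
    (y - x) ^+ 2. *)
Lemma smooth_slope_lipschitz W lam b0 : smooth_slope W lam -> 0 < b0 ->
  exists2 K, 0 <= K & forall x y, b0 <= x -> b0 <= y ->
    `|lam x - lam y| <= K * `|x - y|.
Proof.
move=> Wl b00; have [C C0 HC] := Wl.2 _ b00.
exists (2 * C); first by rewrite mulr_ge0.
move=> x y; wlog xy : x y / x <= y.
  by move=> h bx yb; have /orP[|] := le_total x y => ?; [|rewrite distrC [`|x - y|]distrC];
    exact: h.
move=> bx yb.
have x0 : 0 < x := lt_le_trans b00 bx.
rewrite ger0_norm ?subr_ge0 ?(smooth_slope_nonincr Wl)//.
rewrite ler0_norm ?subr_le0// opprB.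
move: xy; rewrite le_eqVlt => /predU1P[->|xy]; first by rewrite !subrr mulr0.
have h1 := HC _ _ bx yb; have h2 := HC _ _ yb bx.
rewrite -(ler_pM2r (_ : 0 < y - x)) ?subr_gt0//; lra.
Qed.

Lemma smooth_slopeZ W lam w : 0 <= w -> smooth_slope W lam ->
  smooth_slope (fun b => w * W b) (fun b => w * lam b).
Proof.
move=> w0 [W1 W2]; split=> [b y b0 y0|b0 b00].
  by rewrite -mulrA -mulrDr ler_wpM2l// W1.
have [C C0 HC] := W2 _ b00; exists (w * C); first by rewrite mulr_ge0.
by move=> b y bb0 yb0; rewrite -!mulrA -mulrDr -mulrBr ler_wpM2l// HC.
Qed.

Lemma ln_le_tangent b y : 0 < b -> 0 < y -> ln y <= ln b + (y - b) / b.
Proof.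
move=> b0 y0; have yb0 : 0 < y / b by rewrite divr_gt0.
have := le_ln1Dx (x := y / b - 1); rewrite subrKC ln_div// => h.
have -> : (y - b) / b = y / b - 1 by field; rewrite gt_eqF.
by rewrite -lerBlDl h// ltrBrDr addrC subrr.
Qed.

Lemma smooth_slope_ln F mu : smooth_slope F mu ->
  (forall b, 0 < b -> 0 < F b) -> (forall b y, 0 < b -> b <= y -> F b <= F y) ->
  smooth_slope (fun b => ln (F b)) (fun b => mu b / F b).
Proof.
move=> Fmu F0 Fincr; have [F1 F2] := Fmu; split=> [b y b0 y0|b0 b00].
  apply: le_trans (ln_le_tangent (F0 _ b0) (F0 _ y0)) _.
  rewrite lerD2l mulrAC ler_pM2r ?invr_gt0 ?F0//.
  by have := F1 _ _ b0 y0; lra.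
have [C C0 HC] := F2 _ b00.
have f0 := F0 _ b00.
(* The first term is the error of F relative to its least value F b0; the second comes from the
   curvature of ln, the increments of F being at most mu b0 times those of b. *)
exists (C / F b0 + (mu b0 / F b0) ^+ 2).
  by rewrite addr_ge0 ?sqr_ge0// divr_ge0// ltW.
move=> b y bb0 yb0.
have b_gt0 := lt_le_trans b00 bb0; have y_gt0 := lt_le_trans b00 yb0.
have Fb := F0 _ b_gt0; have Fy := F0 _ y_gt0.
have FbL := Fincr _ _ b00 bb0; have FyL := Fincr _ _ b00 yb0.
have mub := smooth_slope_nonincr Fmu b00 bb0.
have muy := smooth_slope_nonincr Fmu b00 yb0.
have lnb := ln_le_tangent Fy Fb.
have D2 : (F y - F b) ^+ 2 <= (mu b0 * (y - b)) ^+ 2.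
  have [by_|yb] := leP b y.
    have h1 := F1 _ _ b_gt0 y_gt0; have h2 := Fincr _ _ b_gt0 by_.
    have h3 : mu b * (y - b) <= mu b0 * (y - b) by rewrite ler_wpM2r// subr_ge0.
    by rewrite ler_sqr ?nnegrE; lra.
  have h1 := F1 _ _ y_gt0 b_gt0; have h2 := Fincr _ _ y_gt0 (ltW yb).
  have h3 : mu y * (b - y) <= mu b0 * (b - y) by rewrite ler_wpM2r// subr_ge0 ltW.
  rewrite -sqrrN -[leRHS]sqrrN ler_sqr ?nnegrE; lra.
have D1 := HC _ _ bb0 yb0.
have e1 : C * (y - b) ^+ 2 / F b <= C * (y - b) ^+ 2 / F b0.
  by rewrite ler_wpM2l ?lef_pV2 ?posrE// mulr_ge0 ?sqr_ge0.
have e2 : (F y - F b) ^+ 2 / (F b * F y) <= (mu b0 * (y - b)) ^+ 2 / (F b0 * F b0).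
  apply: ler_pM => //; rewrite ?sqr_ge0//.
    by rewrite invr_ge0 mulr_ge0// ltW.
  by rewrite lef_pV2 ?posrE ?mulr_gt0// ler_pM// ltW.
have e3 : (mu b * (y - b) - C * (y - b) ^+ 2) / F b <= (F y - F b) / F b.
  by rewrite ler_pM2r ?invr_gt0//; lra.
(* The tangent bound for ln is taken at F y; passing to the quotient by F b costs exactly the
   squared relative increment estimated in [e2]. *)
have e4 : (F b - F y) / F y = (F y - F b) ^+ 2 / (F b * F y) - (F y - F b) / F b.
  by field; rewrite !gt_eqF.
rewrite e4 in lnb; move: lnb e1 e2 e3.
have -> : (mu b0 * (y - b)) ^+ 2 / (F b0 * F b0) = (mu b0 / F b0) ^+ 2 * (y - b) ^+ 2.
  by field; rewrite gt_eqF.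
rewrite mulrBl mulrAC => lnb e1 e2 e3; rewrite mulrDl [C / _ * _]mulrAC; lra.
Qed.

Lemma continuous_at_eps (f : R -> R) (x : R) :
  (forall e, 0 < e -> exists2 d, 0 < d &
    forall y, `|x - y| < d -> `|f x - f y| < e) ->
  {for x, continuous f}.
Proof.
move=> h; apply/cvgrPdist_lt => e /h[d d0 hd]; near=> y; apply: hd; near: y.
exact: (nbhsx_ballx x d d0).
Unshelve. all: by end_near. Qed.

Lemma smooth_slope_continuous W lam b : smooth_slope W lam -> 0 < b ->
  {for b, continuous lam}.
Proof.
move=> Wl b0; have b20 : 0 < b / 2 by rewrite divr_gt0.
have [K K0 HK] := smooth_slope_lipschitz Wl b20.
apply: continuous_at_eps => e e0.
have K1 : 0 < K + 1 by rewrite ltr_wpDl.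
exists (Num.min (b / 2) (e / (K + 1))); first by rewrite lt_min b20 divr_gt0.
move=> y; rewrite lt_min => /andP[by2]; rewrite ltr_pdivlMr// => ye.
have yb : b / 2 <= y by move: by2; rewrite ltr_norml => /andP[_]; lra.
have := HK b y ltac:(lra) yb; have := normr_ge0 (b - y).
by move: ye; set n := `|b - y|; set m := `|_|; nra.
Qed.

(** The slope bounds concern b > 0 only and would allow a jump at 0, hence the separate smallness
    hypothesis. [Num.max 0 b] extends F by the constant F 0, so that continuity can be stated on the
    whole line. *)
Lemma concave_ray_continuous F mu : F 0 = 0 -> (forall b, 0 <= b -> 0 <= F b) ->
  (forall b y, 0 <= b -> b <= y -> F b <= F y) ->
  (forall e, 0 < e -> exists2 d, 0 < d & forall b, 0 < b -> b < d -> F b < e) ->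
  smooth_slope F mu -> continuous (fun b : R => F (Num.max 0 b)).
Proof.
move=> F00 F0 Fincr Fsmall Fmu x; apply: continuous_at_eps => e e0.
have [x0|x0] := leP x 0.
  have [d d0 hd] := Fsmall _ e0; exists d => // y.
  rewrite F00 sub0r normrN => xy.
  have [y0|y0] := leP y 0; first by rewrite F00 normr0.
  rewrite ger0_norm ?F0 ?ltW// hd//.
  by move: xy; rewrite ltr_norml => /andP[+ _]; lra.
have x20 : 0 < x / 2 by rewrite divr_gt0.
pose K := `|mu (x / 2)| + 1.
have K0 : 0 < K by rewrite ltr_wpDl.
exists (Num.min (x / 2) (e / K)); first by rewrite lt_min x20 divr_gt0.
move=> y; rewrite lt_min => /andP[xy2]; rewrite ltr_pdivlMr// => ye.
have yx : x / 2 <= y by move: xy2; rewrite ltr_norml => /andP[_]; lra.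
have y0 : 0 < y by lra.
rewrite max_r ?(ltW y0)//.
have {xy2} : x / 2 <= x by lra.
move: ye x0 y0 yx; move: (x / 2) x20 @K K0 => b b0 /=.
set K := `|mu b| + 1 => K0.
wlog xy : x y / x <= y.
  by move=> h; have /orP[|] := le_total x y => ? ? ? ? ? ?;
    [|rewrite distrC]; apply: h; rewrite // distrC.
move=> ye x0 y0 bly blx.
have h1 := (Fmu.1 _ _ x0 y0); have h2 := smooth_slope_nonincr Fmu b0 blx.
have h3 := Fincr _ _ (ltW x0) xy.
have h4 : mu x <= K by rewrite (le_trans h2)// /K (le_trans (ler_norm _))// lerDl.
move: ye; rewrite !ler0_norm ?subr_le0// !opprB; nra.
Qed.

End concave_ray.

(** * Aggregative games *)

Lemma itv_conv (R : realType) (m M x y t : R) :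
  (`[m, M]%classic : set R) x -> (`[m, M]%classic : set R) y -> 0 <= t <= 1 ->
  (`[m, M]%classic : set R) (t * x + (1 - t) * y).
Proof.
rewrite /= !in_itv/= => /andP[mx xM] /andP[my yM] /andP[t0 t1].
have t1' : 0 <= 1 - t by rewrite subr_ge0.
have := ler_wpM2l t0 mx; have := ler_wpM2l t1' my.
have := ler_wpM2l t0 xM; have := ler_wpM2l t1' yM.
by move=> *; apply/andP; split; lra.
Qed.

Section aggregative_game.
Variables (R : realType) (N : nat) (m M : 'I_N -> R) (A W lam : 'I_N -> R -> R).

Let S i : set R := `[m i, M i].

(** A best reply with the pool term linearized at the aggregate B: the other operators then enter
    only through the price [lam i B]. *)
Definition own_optimum i B x :=
  S i x /\ forall y, S i y -> A i y + lam i B * y <= A i x + lam i B * x.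

Definition aggregative_equilibrium (beta : 'I_N -> R) :=
  (forall i, S i (beta i)) /\
  forall i x, S i x ->
    A i x + W i (\sum_j beta j - beta i + x) <=
    A i (beta i) + W i (\sum_j beta j).

Hypothesis m_gt0 : forall i, 0 < m i.
Hypothesis m_le_M : forall i, m i <= M i.
Hypothesis smoothW : forall i, smooth_slope (W i) (lam i).
Hypothesis contA : forall i, {within S i, continuous (A i)}.
Hypothesis concA : forall i x y t, S i x -> S i y -> 0 <= t <= 1 ->
  t * A i x + (1 - t) * A i y <= A i (t * x + (1 - t) * y).
Hypothesis uniqA : forall i B x y, 0 < B ->
  own_optimum i B x -> own_optimum i B y -> x = y.

Let S_gt0 i x : S i x -> 0 < x.
Proof. by rewrite /S /= in_itv/= => /andP[mx _]; exact: lt_le_trans mx. Qed.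

Let others_ge0 beta i : (forall j, S j (beta j)) -> 0 <= \sum_j beta j - beta i.
Proof.
move=> Sb; rewrite (bigD1 i)//= addrAC subrr add0r sumr_ge0// => j _.
exact/ltW/S_gt0.
Qed.

(** From right to left this is the tangent inequality for W. Conversely, a move by a fraction t
    towards y gains at least t * D up to an error quadratic in t, so equilibrium forces D <= 0. *)
Lemma aggregative_equilibriumP beta : aggregative_equilibrium beta <->
  forall i, own_optimum i (\sum_j beta j) (beta i).
Proof.
set B := \sum_j beta j; split=> [[Sb best] i|best].
  split; first exact: Sb.
  move=> y Sy; set x := beta i.
  have B0 : 0 < B by have := others_ge0 i Sb; have := S_gt0 (Sb i); rewrite -/B; lra.
  have O0 := others_ge0 i Sb; rewrite -/B -/x in O0.
  (* All pools met along the segment are at least [b0], because the others contribute a nonnegative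
     amount; one constant C thus serves every t. *)
  pose b0 := Num.min x y.
  have b00 : 0 < b0 by rewrite lt_min !(S_gt0 (i := i)).
  have [C C0 HC] := (smoothW i).2 _ b00.
  pose D := A i y - A i x + lam i B * (y - x).
  have key t : 0 < t -> t <= 1 -> D <= t * (C * (y - x) ^+ 2).
    move=> t0 t1; have t01 : 0 <= t <= 1 by rewrite ltW.
    pose z := t * y + (1 - t) * x.
    have Sz : S i z by apply: (itv_conv Sy _ t01); exact: Sb.
    have := best i z Sz; rewrite -/B -/x.
    have h1 := concA Sy (Sb i) t01; rewrite -/x -/z in h1.
    have zB : b0 <= B - x + z.
      have : b0 <= z.
        have /andP[bx bY] : (b0 <= x) && (b0 <= y) by rewrite -le_min.
        have := ler_wpM2l (ltW t0) bY.
        have := ler_wpM2l (_ : 0 <= 1 - t) bx; rewrite subr_ge0 => /(_ t1).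
        by rewrite /z; lra.
      by move: O0; lra.
    have xB : b0 <= B.
      have : b0 <= x by rewrite ge_min lexx.
      by move: O0; lra.
    have h2 := HC _ _ xB zB.
    have e1 : B - x + z - B = t * (y - x) by rewrite /z; ring.
    rewrite e1 in h2 => h3.
    rewrite -(ler_pM2l t0).
    have : t * D <= C * (t * (y - x)) ^+ 2 by move: h1 h2 h3; rewrite /D; lra.
    by rewrite exprMn; lra.
  suff : D <= 0 by rewrite /D; lra.
  rewrite leNgt; apply/negP => D0.
  pose Q := C * (y - x) ^+ 2.
  have Q0 : 0 <= Q by rewrite mulr_ge0// sqr_ge0.
  have QD : 0 < Q + D by lra.
  (* This t is at most 1/2 and gives t * Q <= D / 2, against D <= t * Q with D > 0. *)
  have := key (D / (2 * (Q + D))).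
  rewrite divr_gt0 ?mulr_gt0// ler_pdivrMr ?mulr_gt0// -/Q => /(_ isT ltac:(lra)).
  rewrite mulrAC ler_pdivlMr ?mulr_gt0//; nra.
have Sb i : S i (beta i) := (best i).1.
split=> // i x Sx; have [_ bi] := best i.
have O0 := others_ge0 i Sb; have b0 := S_gt0 (Sb i); have x0 := S_gt0 Sx.
rewrite -/B in O0 *.
have := (smoothW i).1 B (B - beta i + x) ltac:(lra) ltac:(lra).
have := bi _ Sx; lra.
Qed.

Lemma own_optimum_exists i B : exists x, own_optimum i B x.
Proof.
have [|x xS xmax] := @EVT_max R (fun x => A i x + lam i B * x) _ _ (m_le_M i).
  move=> x; apply: cvgD; first exact: contA.
  by apply: continuous_subspaceT => y; apply: cvgM; [exact: cvg_cst|exact: cvg_id].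
by exists x; split.
Qed.

(** Adding the two optimality inequalities gives (lam i B - lam i B') * (x' - x) <= 0. If the two
    prices agree, the objectives are the same and uniqueness applies. *)
Lemma own_optimum_antitone i B B' x x' : 0 < B -> B <= B' ->
  own_optimum i B x -> own_optimum i B' x' -> x' <= x.
Proof.
move=> B0 BB' ox ox'.
have B'0 := lt_le_trans B0 BB'.
have := smooth_slope_nonincr (smoothW i) B0 BB'.
rewrite le_eqVlt => /predU1P[lE|ll].
  by rewrite (@uniqA i B x x')// /own_optimum -lE.
have h1 := ox.2 _ ox'.1; have h2 := ox'.2 _ ox.1.
rewrite leNgt; apply/negP => xx'.
have : 0 < (lam i B - lam i B') * (x' - x) by rewrite mulr_gt0// subr_gt0.
lra.
Qed.

(** For B' near B, the points at distance e on either side of [r B] remain strictly worse than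
    [r B]; by concavity the new maximizer cannot lie at or beyond them. *)
Lemma own_optimum_continuous i (r : R -> R) :
  (forall B, own_optimum i B (r B)) -> forall B, 0 < B -> {for B, continuous r}.
Proof.
move=> hr B B0; apply: continuous_at_eps => e e0.
pose phi B x := A i x + lam i B * x.
have strict y : S i y -> y != r B -> phi B y < phi B (r B).
  move=> Sy yr; rewrite lt_neqAle (hr B).2// andbT; apply: contra_neq yr => E.
  by apply: (uniqA B0 _ (hr B)); split=> // z /(hr B).2; rewrite -/(phi B y) E.
(* a point strictly worse than the optimum separates the optima nearby *)
have sep y : S i y -> y != r B -> exists2 d, 0 < d & forall B', `|B - B'| < d ->
    phi B' y < phi B' (r B).
  move=> Sy yr; have := strict y Sy yr; rewrite -subr_gt0; set g := _ - _ => g0.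
  have yr0 : 0 < `|y - r B| by rewrite normr_gt0 subr_eq0.
  have := smooth_slope_continuous (smoothW i) B0 => /cvgrPdist_lt.
  move=> /(_ (g / `|y - r B|) (divr_gt0 g0 yr0)) /nbhs_ballP[d /= d0 hd].
  exists d => // B' BB'; have := hd _ BB'; rewrite ltr_pdivlMr//= -normrM => h.
  rewrite -subr_gt0.
  have -> : phi B' (r B) - phi B' y = g + (lam i B - lam i B') * (y - r B).
    by rewrite /g /phi; ring.
  by move: h; rewrite ltr_norml => /andP[h _]; lra.
have [Sr _] := hr B; move: (Sr); rewrite {1}/S /= in_itv/= => /andP[mr rM].
(* Concavity gives a point between [r B] and the maximizer [r B'] at least the value at [r B], so a
   strictly worse point cannot be there. *)
have betw y B' : phi B' y < phi B' (r B) -> S i y ->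
    ~ (exists2 t, 0 <= t <= 1 & y = t * r B + (1 - t) * r B').
  move=> h Sy [t t01 yE]; have := concA Sr (hr B').1 t01; rewrite -yE => hc.
  have hm := (hr B').2 _ Sy; have hm2 := (hr B').2 _ Sr.
  move: h; rewrite /phi ltNge => /negP; apply.
  have /andP[t0 t1] := t01.
  have := ler_wpM2l t0 hm2; have := ler_wpM2l (_ : 0 <= 1 - t) hm2.
  rewrite subr_ge0 => /(_ t1).
  have : lam i B' * y = t * (lam i B' * r B) + (1 - t) * (lam i B' * r B').
    by rewrite [in LHS]yE; ring.
  lra.
have up : exists2 d, 0 < d & forall B', `|B - B'| < d -> r B' < r B + e.
  have [rM'|rM'] := leP (r B + e) (M i); last first.
    exists 1 => // B' _; have := (hr B').1; rewrite /S /= in_itv/= => /andP[_ h].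
    exact: le_lt_trans h _.
  have Sy : S i (r B + e) by rewrite /S /= in_itv/=; lra.
  have [|d d0 hd] := sep _ Sy; first by lra.
  exists d => // B' /hd h; rewrite ltNge; apply/negP => le'.
  apply: (betw _ _ h Sy); have p0 : 0 < r B' - r B by lra.
  have q0 : 0 < e / (r B' - r B) by rewrite divr_gt0.
  have q1 : e / (r B' - r B) <= 1 by rewrite ler_pdivrMr// mul1r; lra.
  exists (1 - e / (r B' - r B)); first by lra.
  by field; lra.
have dn : exists2 d, 0 < d & forall B', `|B - B'| < d -> r B - e < r B'.
  have [rM'|rM'] := leP (m i) (r B - e); last first.
    exists 1 => // B' _; have := (hr B').1; rewrite /S /= in_itv/= => /andP[h _].
    exact: lt_le_trans h.
  have Sy : S i (r B - e) by rewrite /S /= in_itv/=; lra.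
  have [|d d0 hd] := sep _ Sy; first by lra.
  exists d => // B' /hd h; rewrite ltNge; apply/negP => le'.
  apply: (betw _ _ h Sy); have p0 : 0 < r B - r B' by lra.
  have q0 : 0 < e / (r B - r B') by rewrite divr_gt0.
  have q1 : e / (r B - r B') <= 1 by rewrite ler_pdivrMr// mul1r; lra.
  exists (1 - e / (r B - r B')); first by lra.
  by field; lra.
have [d1 d10 h1] := up; have [d2 d20 h2] := dn.
exists (Num.min d1 d2); first by rewrite lt_min d10.
move=> B'; rewrite lt_min => /andP[/h1 u /h2 l].
by rewrite ltr_norml; lra.
Qed.

Lemma aggregative_equilibrium_unique :
  exists! beta, aggregative_equilibrium beta.
Proof.
have [r hr] : exists r : 'I_N -> R -> R, forall i B, own_optimum i B (r i B).
  have /choice[r hr] : forall iB, exists x, own_optimum iB.1 iB.2 x.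
    by case=> i B; exact: own_optimum_exists.
  by exists (fun i B => r (i, B)) => i B; exact: (hr (i, B)).
pose h B := B - \sum_i r i B.
pose a := \sum_i m i; pose b := \sum_i M i.
have rm i B : m i <= r i B by have := (hr i B).1; rewrite /S /= in_itv/= => /andP[].
have rM i B : r i B <= M i by have := (hr i B).1; rewrite /S /= in_itv/= => /andP[].
have ab : a <= b by apply: ler_sum.
(* Positivity is tied to the presence of an index, since [a] is 0 for N = 0. *)
have a0 (i : 'I_N) : 0 < a.
  by rewrite /a (bigD1 i)//= ltr_pwDl// sumr_ge0// => j _; exact: ltW.
have [||B Bab hB] := @IVT R h a b 0 ab.
- apply: continuous_in_subspaceT => B; rewrite inE /= in_itv/= => /andP[aB _].
  apply: cvgB; first exact: cvg_id.
  apply: cvg_big => [|i _]; first exact: add_continuous.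
  exact: (own_optimum_continuous (hr i) (lt_le_trans (a0 i) aB)).
- rewrite ge_min le_max; apply/andP; split; apply/orP.
    by left; rewrite subr_le0 ler_sum.
  by right; rewrite subr_ge0 ler_sum.
have {hB} BE : \sum_i r i B = B by apply/esym/eqP; rewrite -subr_eq0; apply/eqP.
exists (r ^~ B); split.
  by apply/aggregative_equilibriumP => i; rewrite BE.
move=> beta /aggregative_equilibriumP hb; apply/funext => i.
set B' := \sum_j beta j in hb.
have B0 (j : 'I_N) : 0 < B.
  by move: Bab; rewrite in_itv/= => /andP[+ _]; exact: lt_le_trans (a0 j).
have aB' : a <= B'.
  by apply: ler_sum => j _; have := (hb j).1; rewrite /S /= in_itv/= => /andP[].
suff BB' : B = B' by apply: (uniqA (B0 i) (hr i B)); rewrite BB'.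
apply/eqP; rewrite eq_le; apply/andP; split; rewrite leNgt; apply/negP => lt.
  have : B <= B'.
    rewrite -BE; apply: ler_sum => j _.
    exact: (own_optimum_antitone (lt_le_trans (a0 j) aB') (ltW lt) (hb j) (hr j B)).
  by rewrite leNgt lt.
have : B' <= B.
  rewrite -BE; apply: ler_sum => j _.
  exact: (own_optimum_antitone (B0 j) (ltW lt) (hr j B) (hb j)).
by rewrite leNgt lt.
Qed.

End aggregative_game.

(** * Band rates *)

Section tonelli_on.
Variable R : realType.
Notation mu := (@lebesgue_measure R).
Variables (D1 D2 : set (measurableTypeR R)) (h : measurableTypeR R * measurableTypeR R -> R).
Hypotheses (mD1 : measurable D1) (mD2 : measurable D2).
Hypothesis mh : measurable_fun (D1 `*` D2) h.
Hypothesis h0 : forall p, (D1 `*` D2) p -> 0 <= h p.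

(** Extension by zero, so that Tonelli on the whole plane applies. *)
Let g (p : measurableTypeR R * measurableTypeR R) : \bar R := ((h \_ (D1 `*` D2)) p)%:E.

Let mg : measurable_fun setT g.
Proof.
apply/measurable_EFinP; apply/(measurable_restrict h) => //.
  exact: measurableX.
by rewrite setTI.
Qed.

Let g0 p : (0 <= g p)%E.
Proof. by rewrite lee_fin; apply: restrict_ge0. Qed.

Let gF x : (\int[mu]_y g (x, y) =
  ((fun x => \int[mu]_(y in D2) (h (x, y))%:E) \_ D1) x)%E.
Proof.
rewrite patchE; case: ifPn => xD1.
  rewrite [RHS]integral_mkcond; apply: eq_integral => y _.
  by rewrite /g !patchE in_setX/= xD1 /=; case: ifP.
by rewrite integral0_eq// => y _; rewrite /g patchE in_setX/= (negbTE xD1).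
Qed.

Let gG y : (\int[mu]_x g (x, y) =
  ((fun y => \int[mu]_(x in D1) (h (x, y))%:E) \_ D2) y)%E.
Proof.
rewrite patchE; case: ifPn => yD2.
  rewrite [RHS]integral_mkcond; apply: eq_integral => x _.
  by rewrite /g !patchE in_setX/= yD2 andbT; case: ifP.
by rewrite integral0_eq// => x _; rewrite /g patchE in_setX/= (negbTE yD2) andbF.
Qed.

Lemma tonelli_on :
  (\int[mu]_(x in D1) \int[mu]_(y in D2) (h (x, y))%:E =
   \int[mu]_(y in D2) \int[mu]_(x in D1) (h (x, y))%:E)%E.
Proof.
rewrite [LHS]integral_mkcond [RHS]integral_mkcond.
under eq_integral do rewrite -gF.
under [RHS]eq_integral do rewrite -gG.
exact: fubini_tonelli.
Qed.

Lemma measurable_tonelli_on :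
  measurable_fun D2 (fun y => \int[mu]_(x in D1) (h (x, y))%:E)%E.
Proof.
apply/(measurable_restrictT _ mD2).
rewrite (_ : _ \_ _ = fubini_G mu g); last by apply/funext => y; rewrite -gG.
exact: measurable_fun_fubini_tonelli_G.
Qed.

End tonelli_on.

(** * Laplace transform of the interference *)

Section laplace_transform.
Context (R : realType) (d : measure_display) (T : measurableType d)
  (P : probability T R) (m : mode P).
Hypothesis I_ge0 : forall t, 0 <= interference m t.

Let ex s t : R := expR (- (s * interference m t)).

Let mex s : measurable_fun setT (ex s).
Proof.
apply: measurableT_comp => //; apply: measurableT_comp => //.
by apply: measurable_funM => //; exact: measurable_funP.
Qed.

Let iex s : 0 <= s -> P.-integrable setT (EFin \o ex s).
Proof.
move=> s0; apply: le_integrable (finite_measure_integrable_cst P 1 measurableT) => //.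
  by apply/measurable_EFinP; exact: mex.
move=> t _; rewrite lee_fin normr1 ger0_norm ?expR_ge0//.
by rewrite expR_le1 oppr_le0 mulr_ge0.
Qed.

Lemma laplaceE s : laplace m s = \int[P]_t ex s t.
Proof.
rewrite /laplace /mmt_gen_fun unlock /Rintegral; congr fine.
apply: eq_integral => t _ /=.
by rewrite /ex; congr (expR _)%:E; ring.
Qed.

Lemma laplace_gt0 s : 0 <= s -> 0 < laplace m s.
Proof.
move=> s0; rewrite laplaceE; apply: Rintegral_gt0 => //; first exact: iex.
  by move=> t _; exact: expR_ge0.
case=> N [mN N0 sN].
have NT : N = setT.
  apply/seteqP; split=> // t _; apply: sN => /= /(_ I) [] /eqP.
  by rewrite gt_eqF ?expR_gt0.
by have := probability_setT P; rewrite -NT N0 => -[] /eqP; rewrite eq_sym oner_eq0.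
Qed.

Lemma laplace_nonincr s s' : 0 <= s -> s <= s' -> laplace m s' <= laplace m s.
Proof.
move=> s0 ss'; rewrite !laplaceE le_Rintegral//; [|exact: iex|].
  by apply: iex; exact: le_trans ss'.
by move=> t _; rewrite ler_expR lerN2 ler_wpM2r.
Qed.

Lemma laplace_le1 s : 0 <= s -> laplace m s <= 1.
Proof.
move=> s0; apply: le_trans (laplace_nonincr (lexx 0) s0) _.
rewrite laplaceE (@eq_Rintegral _ _ _ _ _ (cst 1)).
  by rewrite Rintegral_cst// [X in fine X](probability_setT P) mul1r.
by move=> t _; rewrite /ex mul0r oppr0 expR0.
Qed.

(** Measurability comes from monotonicity. The truncation keeps the argument nonnegative, since for
    s < 0 the expectation may be infinite and [fine] would return a default value. *)
Lemma measurable_laplace : measurable_fun (setT : set R) (fun s : R => laplace m (Num.max 0 s)).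
Proof.
apply: nonincreasing_measurable => // s s' ss'.
apply: laplace_nonincr; first by rewrite le_max lexx.
by rewrite ge_max le_max lexx/= le_max ss' orbT.
Qed.

End laplace_transform.

(** * The band rate of a mode as an average of kernel masses *)

Section mode_rate.
Context (R : realType) (d : measure_display) (T : measurableType d)
  (P : probability T R) (E : environment R) (m : mode P).
Hypotheses (E_ok : environment_ok E) (m_ok : mode_ok E m).

Notation mu := (@lebesgue_measure R).
Let Dg : set (measurableTypeR R) := `[0, +oo[.
Let Dx : set (measurableTypeR R) := `]0, +oo[.

Let mDg : measurable Dg. Proof. exact: measurable_itv. Qed.
Let mDx : measurable Dx. Proof. exact: measurable_itv. Qed.

(** The reciprocal of the mean received power, so that [sinr_arg] is gamma times it. The noise
    factor then reads expR (- (b * (noise_rate x * gamma))), and [interference_weight x] plays the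
    role of psi. *)
Definition link_gain (x : R) : R := (power m * pathloss E x)^-1.
Definition noise_rate (x : R) : R := noise E * link_gain x.
Definition interference_weight (x gamma : R) : R :=
  laplace m (gamma * link_gain x) / (1 + gamma).
Definition link_mass (b x : R) : R :=
  weighted_mass (noise_rate x) (interference_weight x) b.

Let DgE (z : R) : Dg z = (0 <= z) :> Prop.
Proof. by rewrite /Dg /= in_itv/= andbT. Qed.

Let DxE (z : R) : Dx z = (0 < z) :> Prop.
Proof. by rewrite /Dx /= in_itv/= andbT. Qed.

Let gain_gt0 x : 0 < x -> 0 < link_gain x.
Proof. by move=> x0; rewrite invr_gt0 mulr_gt0 ?(power_gt0 m_ok) ?(pathloss_gt0 E_ok). Qed.

Lemma noise_rate_gt0 x : 0 < x -> 0 < noise_rate x.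
Proof. by move=> x0; rewrite mulr_gt0 ?(noise_gt0 E_ok) ?gain_gt0. Qed.

Let I0 := interference_ge0 m_ok.

Lemma interference_weight_ge0 x gamma : 0 < x -> 0 <= gamma ->
  0 <= interference_weight x gamma.
Proof.
move=> x0 g0; rewrite divr_ge0 ?addr_ge0// ltW// laplace_gt0// mulr_ge0//.
exact/ltW/gain_gt0.
Qed.

Lemma interference_weight_le x gamma : 0 < x -> 0 <= gamma ->
  interference_weight x gamma <= (1 + gamma)^-1.
Proof.
move=> x0 g0; rewrite ler_piMl ?invr_ge0 ?addr_ge0// laplace_le1// mulr_ge0//.
exact/ltW/gain_gt0.
Qed.

Lemma interference_weight_le1 x gamma : 0 < x -> 0 <= gamma ->
  interference_weight x gamma <= 1.
Proof.
move=> x0 g0; apply: le_trans (interference_weight_le x0 g0) _.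
by rewrite invf_le1 ?lerDl// ltr_wpDr.
Qed.

(** Strictness comes from the factor (1 + gamma)^-1; the Laplace factor may be constant, as it is
    without interference. *)
Lemma interference_weight_decr x z y : 0 < x -> 0 <= z -> z < y ->
  interference_weight x y < interference_weight x z.
Proof.
move=> x0 z0 zy; have gx := gain_gt0 x0.
have y0 := le_lt_trans z0 zy.
have zg0 : 0 <= z * link_gain x by rewrite mulr_ge0// ltW.
have zyg : z * link_gain x <= y * link_gain x by rewrite ler_wpM2r// ltW.
apply: (@le_lt_trans _ _ (laplace m (z * link_gain x) / (1 + y))).
  by rewrite ler_wpM2r ?laplace_nonincr// invr_ge0 addr_ge0// ltW.
rewrite ltr_pM2l ?laplace_gt0// ltf_pV2 ?posrE ?ltrD2l//; lra.
Qed.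

Lemma measurable_interference_weight x : 0 < x ->
  measurable_fun (`[0, +oo[ : set R) (interference_weight x).
Proof.
move=> x0; apply: measurable_funM.
  apply: (@eq_measurable_fun _ _ _ _ _
    (fun z : R => laplace m (Num.max 0 (z * link_gain x)))).
    move=> z /set_mem; rewrite /= in_itv/= andbT => z0.
    by rewrite max_r// mulr_ge0// ltW// gain_gt0.
  apply: (measurableT_comp (measurable_laplace I0)).
  exact: measurable_funM.
apply: (@eq_measurable_fun _ _ _ _ _ (fun z : R => (1 + z) `^ (-1))).
  by move=> z /set_mem; rewrite /= in_itv/= andbT => z0; rewrite powR_inv1// addr_ge0.
apply: (measurableT_comp (measurable_powR _)).
exact: measurable_funD.
Qed.

Let mgain : measurable_fun Dx link_gain.
Proof.
apply: (@eq_measurable_fun _ _ _ _ _ (fun x => (power m * pathloss E x) `^ (-1))).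
  move=> x /set_mem; rewrite DxE => x0; rewrite powR_inv1//.
  by rewrite mulr_ge0// ltW ?(power_gt0 m_ok) ?(pathloss_gt0 E_ok).
apply: (measurableT_comp (measurable_powR _)).
by apply: measurable_funM => //; exact: (measurable_pathloss E_ok).
Qed.

(** The joint integrand in gamma ([p.1]) and distance ([p.2]), without the activity. Integrating
    over gamma gives the link masses, over distance the coverage. *)
Let h b (p : measurableTypeR R * measurableTypeR R) : R :=
  link_density m p.2 *
    (expdens b (noise_rate p.2 * p.1) * interference_weight p.2 p.1).

Let mh b : measurable_fun (Dg `*` Dx) (h b).
Proof.
have m2 (f : R -> R) : measurable_fun Dx f -> measurable_fun (Dg `*` Dx) (f \o snd).
  move=> mf; apply: measurable_comp mf _ => //.
    by move=> _ [p [_ +] <-].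
  exact: measurable_funTS.
have m1 : measurable_fun (Dg `*` Dx) (fst : R * R -> R) by exact: measurable_funTS.
have mgain2 := m2 _ mgain.
apply: measurable_funM; first exact: m2 (measurable_link_density m_ok).
apply: measurable_funM.
  apply: measurable_funM => //; apply: measurableT_comp => //.
  apply: measurableT_comp => //; apply: measurable_funM => //.
  by do 2 apply: measurable_funM => //.
apply: measurable_funM.
  apply: (@eq_measurable_fun _ _ _ _ _
    (fun p : R * R => laplace m (Num.max 0 (p.1 * link_gain p.2)))).
    move=> p /set_mem [/=]; rewrite DgE DxE => p1 p2.
    by rewrite max_r// mulr_ge0// ltW// gain_gt0.
  apply: (measurableT_comp (measurable_laplace I0)).
  exact: measurable_funM.
apply: (@eq_measurable_fun _ _ _ _ _ (fun p : R * R => (1 + p.1) `^ (-1))).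
  by move=> p /set_mem [/=]; rewrite DgE => p1 _; rewrite powR_inv1// addr_ge0.
apply: (measurableT_comp (measurable_powR _)).
exact: measurable_funD.
Qed.

Let h_ge0 b p : 0 <= b -> (Dg `*` Dx) p -> 0 <= h b p.
Proof.
move=> b0 []; rewrite DgE DxE => p1 p2.
rewrite mulr_ge0 ?(link_density_ge0 m_ok)// mulr_ge0 ?expdens_ge0//.
exact: interference_weight_ge0.
Qed.

Let integrable_mass b x : 0 < x -> 0 <= b -> mu.-integrable Dg
  (fun z => (expdens b (noise_rate x * z) * interference_weight x z)%:E).
Proof.
move=> x0 b0; apply: integrable_expdens_weight => //.
- exact: noise_rate_gt0.
- exact: measurable_interference_weight.
- by move=> z z0; exact: interference_weight_ge0.
- by move=> z z0; exact: interference_weight_le1.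
Qed.

Let int_h_gamma b x : 0 <= b -> Dx x ->
  (\int[mu]_(z in Dg) (h b (z, x))%:E = (link_density m x * link_mass b x)%:E)%E.
Proof.
rewrite DxE => b0 x0; have i := integrable_mass x0 b0.
under eq_integral do rewrite /h/= EFinM.
by rewrite integralZl// EFinM /link_mass /weighted_mass /Rintegral fineK// integrable_fin_num.
Qed.

Lemma integrable_link_density : mu.-integrable Dx (EFin \o link_density m).
Proof.
apply/integrableP; split.
  by apply/measurable_EFinP; exact: (measurable_link_density m_ok).
under eq_integral => x /set_mem Dxx.
  rewrite gee0_abs ?lee_fin ?(link_density_ge0 m_ok)//; last by rewrite -DxE.
  over.
by rewrite (link_density_total m_ok) ltry.
Qed.

Let int_h_link b z : 0 < b -> Dg z ->
  (\int[mu]_(x in Dx) (h b (z, x))%:E = (b * coverage E m b z / (1 + z))%:E)%E.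
Proof.
rewrite DgE => b0 z0.
pose k x := link_density m x * expR (- (noise E * b * sinr_arg E m z x)) *
  laplace m (sinr_arg E m z x).
have kh x : h b (z, x) = b / (1 + z) * k x.
  rewrite /h /k /expdens /interference_weight /sinr_arg /= /noise_rate.
  rewrite -/(link_gain x) (_ : b * (_ * z) = noise E * b * (z * link_gain x)); last by ring.
  by move: (expR _) (laplace _ _) (1 + z)^-1 => u v w; ring.
have mk : measurable_fun Dx k.
  have mS : measurable_fun Dx (fun x => z * link_gain x) by exact: measurable_funM.
  apply: measurable_funM; first apply: measurable_funM.
  - exact: (measurable_link_density m_ok).
  - apply: measurableT_comp => //; apply: measurableT_comp => //.
    exact: measurable_funM.
  - apply: (@eq_measurable_fun _ _ _ _ _
      (fun x : R => laplace m (Num.max 0 (z * link_gain x)))).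
      move=> x /set_mem; rewrite DxE => x0.
      by rewrite max_r// mulr_ge0// ltW// gain_gt0.
    exact: (measurableT_comp (measurable_laplace I0)).
have ik : mu.-integrable Dx (EFin \o k).
  apply: le_integrable integrable_link_density => //; first exact/measurable_EFinP.
  move=> x; rewrite DxE => x0; have f0 := link_density_ge0 m_ok x0.
  have s0 : 0 <= sinr_arg E m z x by rewrite mulr_ge0// ltW// gain_gt0.
  have L0 := laplace_gt0 I0 s0; have L1 := laplace_le1 I0 s0.
  have k0 : 0 <= k x by rewrite !mulr_ge0 ?expR_ge0 ?(ltW L0).
  rewrite lee_fin !ger0_norm// /k -mulrA ler_piMr// mulr_ile1 ?expR_ge0 ?(ltW L0)//.
  rewrite expR_le1 oppr_le0 mulr_ge0// mulr_ge0 ?(ltW b0)//.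
  exact/ltW/(noise_gt0 E_ok).
under eq_integral do rewrite kh EFinM.
rewrite integralZl// -[(\int[mu]_(x in Dx) _)%E]fineK ?integrable_fin_num//.
by rewrite -EFinM; congr (_%:E); rewrite /coverage /Rintegral mulrAC.
Qed.

(** Tonelli applied to [h]. Finiteness of the spectral efficiency is what makes the link masses
    integrable against the link density. *)
Lemma band_rate_integral b : 0 <= b ->
  mu.-integrable Dx (EFin \o fun x => link_density m x * link_mass b x) /\
  band_rate E m b = activity m * \int[mu]_(x in Dx) (link_density m x * link_mass b x).
Proof.
(* [efficiency_finite] covers only b > 0; at b = 0 the factor b makes both sides vanish. *)
rewrite le_eqVlt => /predU1P[<-|b0].
  have l0 x : link_density m x * link_mass 0 x = 0.
    rewrite /link_mass /weighted_mass (@eq_Rintegral _ _ _ _ _ (cst 0)).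
      by rewrite Rintegral_cst ?mul0r ?mulr0//; exact: mDg.
    by move=> z _; rewrite /expdens !mul0r.
  split.
    apply: eq_integrable (integrable0 _ _) => // x _.
    by rewrite /= l0.
  rewrite /band_rate mul0r (@eq_Rintegral _ _ _ _ _ (cst 0)).
    by rewrite Rintegral_cst ?mul0r ?mulr0//; exact: mDx.
  by move=> x _; rewrite l0.
have nu0 := activity_gt0 m_ok.
have eff := efficiency_finite m_ok b0.
have tot : (\int[mu]_(x in Dx) (link_density m x * link_mass b x)%:E =
    (b / activity m * spectral_efficiency E m b)%:E)%E.
  transitivity (\int[mu]_(x in Dx) \int[mu]_(z in Dg) (h b (z, x))%:E)%E.
    by apply: eq_integral => x /set_mem Dxx; rewrite int_h_gamma// ltW.
  rewrite -(tonelli_on mDg mDx (mh b)); last by move=> p; exact/h_ge0/ltW.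
  transitivity (\int[mu]_(z in Dg) ((b / activity m)%:E * (efficiency_density E m b z)%:E))%E.
    apply: eq_integral => z /set_mem Dgz; rewrite int_h_link// -EFinM.
    by congr (_%:E); rewrite /efficiency_density; field; rewrite !gt_eqF//; rewrite DgE in Dgz; lra.
  by rewrite integralZl// [RHS]EFinM /spectral_efficiency /Rintegral fineK// integrable_fin_num.
split; last first.
  rewrite [X in _ * X]/Rintegral tot /= /band_rate; field.
  by rewrite gt_eqF.
apply/integrableP; split.
  have := measurable_tonelli_on mDg mDx (mh b) (fun p => @h_ge0 b p (ltW b0)).
  apply: eq_measurable_fun => x /set_mem Dxx.
  by rewrite int_h_gamma// ltW.
under eq_integral => x /set_mem Dxx.
  rewrite gee0_abs; last first.
    rewrite /= -int_h_gamma ?(ltW b0)//; apply: integral_ge0 => z Dgz.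
    by rewrite lee_fin h_ge0// ltW.
  over.
by rewrite tot ltry.
Qed.

Let c0 := noise_rate_gt0.
Let psi_m := measurable_interference_weight.
Let psi0 x (x0 : 0 < x) z (z0 : 0 <= z) := interference_weight_ge0 x0 z0.
Let psi1 x (x0 : 0 < x) z (z0 : 0 <= z) := interference_weight_le1 x0 z0.
Let psi_d x (x0 : 0 < x) z y (z0 : 0 <= z) (zy : z < y) :=
  interference_weight_decr x0 z0 zy.

Let mass_concave x (x0 : 0 < x) :=
  weighted_mass_strictly_concave (c0 x0) (psi_m x0) (psi0 x0) (psi1 x0) (psi_d x0).

Let mass_ge0 b x : 0 < x -> 0 <= b -> 0 <= link_mass b x.
Proof. by move=> x0 b0; apply: weighted_mass_ge0 => // z z0; exact: interference_weight_ge0. Qed.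

Let f0 x (x0 : 0 < x) := link_density_ge0 m_ok x0.
Let nu0 := activity_gt0 m_ok.

Lemma band_rate_ge0 b : 0 <= b -> 0 <= band_rate E m b.
Proof.
move=> b0; have [_ ->] := band_rate_integral b0.
rewrite mulr_ge0 ?(ltW nu0)// Rintegral_ge0// => x; rewrite DxE => x0.
by rewrite mulr_ge0 ?f0 ?mass_ge0.
Qed.

Lemma link_density_neq0 : ~ ae_eq mu Dx (EFin \o link_density m) (cst 0%E).
Proof.
move=> ae0; have := link_density_total m_ok.
rewrite (ae_eq_integral (cst 0%E))//.
  by rewrite integral0 => -[] /eqP; rewrite eq_sym oner_eq0.
exact: measurable_int integrable_link_density.
Qed.

(** The Jensen gap [g x] of the link mass is positive at every distance, so its average could vanish
    only if the link density were almost everywhere 0, against its total mass 1. *)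
Lemma band_rate_strictly_concave : strictly_concave_ray (band_rate E m).
Proof.
move=> b1 b2 t b10 b12 t01; have /andP[t0 t1] := t01.
have b20 := le_trans b10 (ltW b12).
have b0 : 0 <= t * b1 + (1 - t) * b2 by rewrite addr_ge0 ?mulr_ge0 ?subr_ge0// ltW.
have [i1 ->] := band_rate_integral b10.
have [i2 ->] := band_rate_integral b20.
have [i ->] := band_rate_integral b0.
have [j J] := Rintegral_lincomb3 1 (- t) (- (1 - t)) mDx i i1 i2.
rewrite ![_ * (activity m * _)]mulrCA -mulrDr ltr_pM2l ?nu0// -subr_gt0.
rewrite (_ : _ - _ = \int[mu]_(x in Dx)
  (1 * (link_density m x * link_mass (t * b1 + (1 - t) * b2) x) +
   - t * (link_density m x * link_mass b1 x) +
   - (1 - t) * (link_density m x * link_mass b2 x))); last first.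
  by rewrite J mul1r !mulNr opprD addrA.
pose g x := link_mass (t * b1 + (1 - t) * b2) x -
  (t * link_mass b1 x + (1 - t) * link_mass b2 x).
have gE x : 1 * (link_density m x * link_mass (t * b1 + (1 - t) * b2) x) +
   - t * (link_density m x * link_mass b1 x) +
   - (1 - t) * (link_density m x * link_mass b2 x) = link_density m x * g x.
  rewrite /g; move: (link_density m x) (link_mass _ x) (link_mass _ x) (link_mass _ x).
  by move=> u v v1 v2; ring.
have g0 x : 0 < x -> 0 < g x.
  by move=> x0; rewrite subr_gt0; exact: mass_concave.
apply: Rintegral_gt0 => //.
  by move=> x; rewrite DxE => x0; rewrite gE mulr_ge0 ?f0// ltW// g0.
move=> ae; apply: link_density_neq0; move: ae; apply: filterS => x hx Dxx.
have := hx Dxx; rewrite /= gE => -[] /eqP; rewrite mulf_eq0 [g x == 0]gt_eqF.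
  by rewrite orbF => /eqP ->.
by move: Dxx; rewrite DxE; exact: g0.
Qed.

Lemma band_rate_div_nonincr b y : 0 < b -> b <= y ->
  band_rate E m y / y <= band_rate E m b / b.
Proof.
move=> b0 by_; have y0 := lt_le_trans b0 by_.
have [i1 ->] := band_rate_integral (ltW b0).
have [i2 ->] := band_rate_integral (ltW y0).
rewrite -[leLHS]mulrA -[leRHS]mulrA; apply: ler_wpM2l; first exact: ltW.
have := @Rintegral_lincomb3_ge0 _ _ _ mu Dx _ _ _ b^-1 (- y^-1) 0 mDx i1 i2 i2.
rewrite mul0r addr0 mulNr subr_ge0 [leLHS]mulrC [leRHS]mulrC; apply => x.
rewrite DxE mul0r addr0 mulNr subr_ge0 [leLHS]mulrC [leRHS]mulrC => x0.
rewrite -[leLHS]mulrA -[leRHS]mulrA; apply: ler_wpM2l; first exact: f0.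
exact: (weighted_mass_div_nonincr (c0 x0) (psi_m x0) (psi0 x0) (psi1 x0)).
Qed.

Lemma band_rate_div_convex b1 b2 t : 0 < b1 -> 0 < b2 -> 0 <= t <= 1 ->
  0 < t * b1 + (1 - t) * b2 ->
  band_rate E m (t * b1 + (1 - t) * b2) / (t * b1 + (1 - t) * b2) <=
    t * (band_rate E m b1 / b1) + (1 - t) * (band_rate E m b2 / b2).
Proof.
move=> b10 b20 t01 b0.
have [i1 ->] := band_rate_integral (ltW b10).
have [i2 ->] := band_rate_integral (ltW b20).
have [i ->] := band_rate_integral (ltW b0).
set b := t * b1 + _ in b0 i *.
have scaled (k I1 I2 I3 : R) : 0 <= k ->
    0 <= t / b1 * I1 + (1 - t) / b2 * I2 + - b^-1 * I3 ->
    k * I3 / b <= t * (k * I1 / b1) + (1 - t) * (k * I2 / b2).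
  move=> k0 /(mulr_ge0 k0); rewrite -[_ <= _ + _]subr_ge0; move: b^-1 b1^-1 b2^-1 => v v1 v2.
  by move=> hI; apply: le_trans hI _; rewrite le_eqVlt; apply/orP; left; apply/eqP; ring.
apply: scaled; first exact: ltW.
apply: (Rintegral_lincomb3_ge0 mDx i1 i2 i) => x; rewrite DxE => x0.
have := weighted_mass_div_convex (c0 x0) (psi_m x0) (psi0 x0) (psi1 x0) b10 b20 t01.
rewrite -/b -/(link_mass b x) -/(link_mass b1 x) -/(link_mass b2 x).
move: (f0 x0) (link_mass b x) (link_mass b1 x) (link_mass b2 x).
move: (link_density m x) b^-1 b1^-1 b2^-1 => u v v1 v2 u0 J J1 J2.
rewrite -subr_ge0 => /(mulr_ge0 u0) hJ.
by apply: le_trans hJ _; rewrite le_eqVlt; apply/orP; left; apply/eqP; ring.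
Qed.

Let link_mass_small x e : 0 < x -> 0 < e ->
  exists2 d, 0 < d & forall b, 0 <= b -> b < d -> link_mass b x < e.
Proof.
move=> x0 e0; pose c := noise_rate x; have c_gt0 : 0 < c := c0 x0.
(* With this [a] the tail term is at most a^-1 / c = e / 2, and the bound on b makes a * b < e /
   2. *)
pose a := 2 / (e * c); have a0 : 0 < a by rewrite divr_gt0// mulr_gt0.
exists (e / 2 / a); first by apply: divr_gt0 => //; exact: divr_gt0.
move=> b b0; rewrite ltr_pdivlMr// mulrC => abe.
have := weighted_mass_le (c0 x0) (psi_m x0) (psi0 x0) (psi1 x0) (psi_d x0) (ltW a0) b0.
move=> /le_lt_trans; apply; rewrite [ltRHS](splitr e) ltr_leD//.
rewrite -/c ler_pdivrMr//; apply: le_trans (interference_weight_le x0 (ltW a0)) _.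
have -> : e / 2 * c = a^-1 by rewrite /a; field; rewrite !gt_eqF.
by rewrite lef_pV2 ?posrE ?addr_gt0// lerDr.
Qed.

Let link_mass_nondecr x b y : 0 < x -> 0 <= b -> b <= y -> link_mass b x <= link_mass y x.
Proof.
move=> x0; apply: (@concave_ray_nondecr _ (link_mass ^~ x)); first exact: mass_concave.
by move=> *; exact: mass_ge0.
Qed.

(** Dominated convergence along b = 1 / (n + 1), dominated by the integrand at b = 1; monotonicity
    covers the remaining b. *)
Lemma band_rate_small e : 0 < e -> exists2 d, 0 < d &
  forall b, 0 < b -> b < d -> band_rate E m b < e.
Proof.
move=> e0; pose u n x := link_density m x * link_mass n.+1%:R^-1 x.
have n0 n : 0 <= n.+1%:R^-1 :> R by rewrite invr_ge0.
have [i1 _] := band_rate_integral ler01.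
have iu n := (band_rate_integral (n0 n)).1.
have [|||_ _] := dominated_convergence mDx (f_ := fun n x => (u n x)%:E) (f := cst 0%E)
  (fun n => measurable_int _ (iu n)) _ _ i1.
- by [].
- apply: aeW => x; rewrite DxE => x0; apply/cvg_EFin; first exact: nearW.
  rewrite -[X in _ --> X](mulr0 (link_density m x)).
  apply: (cvgM (cvg_cst (link_density m x))).
  apply/cvgrPdist_lt => e' /(link_mass_small x0)[r r0 hr]; near=> n.
  rewrite sub0r normrN ger0_norm ?mass_ge0// hr//.
  by near: n; exact: (near_infty_natSinv_lt (PosNum r0)).
- apply: aeW => x n; rewrite DxE => x0.
  rewrite lee_fin ger0_norm ?mulr_ge0 ?mass_ge0 ?f0//.
  by rewrite ler_wpM2l ?f0// link_mass_nondecr// invf_le1// ler1n.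
rewrite integral_cst// mul0e => /fine_cvg/cvgrPdist_lt.
move=> /(_ (e / activity m)); rewrite divr_gt0// => /(_ isT) [n _ /(_ n (leqnn _))] /=.
rewrite sub0r normrN => hn; exists n.+1%:R^-1; first by rewrite invr_gt0.
move=> b b0 bn; apply: lt_trans (concave_ray_incr band_rate_strictly_concave
  (@band_rate_ge0) (ltW b0) bn) _.
have [_ ->] := band_rate_integral (n0 n).
rewrite mulrC -ltr_pdivlMr//; apply: le_lt_trans hn.
exact: ler_norm.
Unshelve. all: by end_near. Qed.

(** With F b = b * G b, convexity of G bounds the failure of convexity of F by t * (1 - t) * (b2 -
    b1) * (G b1 - G b2), so a Lipschitz bound for G on [b0, +oo) suffices. *)
Lemma band_rate_semiconvex : semiconvex (band_rate E m).
Proof.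
move=> b0 b00; pose G b := band_rate E m b / b.
have FG b : 0 < b -> band_rate E m b = b * G b.
  by move=> b_gt0; rewrite /G mulrC divfK// gt_eqF.
have Gni x y : 0 < x -> x <= y -> G y <= G x by exact: band_rate_div_nonincr.
have Gconv x y t : 0 < x -> 0 < y -> 0 <= t <= 1 -> 0 < t * x + (1 - t) * y ->
    G (t * x + (1 - t) * y) <= t * G x + (1 - t) * G y.
  by exact: band_rate_div_convex.
have G0 b : 0 < b -> 0 <= G b.
  by move=> b_gt0; rewrite divr_ge0 ?band_rate_ge0// ltW.
(* Half of [b0] leaves room on the left: by convexity the descent of G past b0 is no steeper than
   its secant from c, of slope at most G c / c in absolute value since b2 - c >= c. *)
pose c := b0 / 2; have c_gt0 : 0 < c by rewrite divr_gt0.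
have b0c : b0 = 2 * c by rewrite /c; field.
have K0 : 0 <= G c / c by rewrite divr_ge0 ?G0// ltW.
exists (G c / c) => // b1 b2 t b01 b02 t01; have /andP[t0 t1] := t01.
have key : (b2 - b1) * (G b1 - G b2) <= G c / c * (b1 - b2) ^+ 2.
  wlog b12 : b1 b2 b01 b02 / b1 <= b2.
    move=> hw; have /orP[|] := le_total b1 b2 => b12; first exact: hw.
    by have := hw _ _ b02 b01 b12; lra.
  move: b12; rewrite le_eqVlt => /predU1P[->|b12].
    by rewrite !subrr mul0r expr0n mulr0.
  have p0 : 0 < b2 - c by lra.
  pose s := (b2 - b1) / (b2 - c).
  have s0 : 0 <= s by rewrite divr_ge0; lra.
  have s1 : s <= 1 by rewrite ler_pdivrMr// mul1r; lra.
  have sE : s * c + (1 - s) * b2 = b1 by rewrite /s; field; rewrite gt_eqF.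
  have s01 : 0 <= s <= 1 by rewrite s0.
  have hG : G (s * c + (1 - s) * b2) <= s * G c + (1 - s) * G b2.
    by apply: (Gconv c b2 s) => //; rewrite ?sE; lra.
  rewrite sE in hG.
  have h1 : s * (G c - G b2) <= s * G c.
    by rewrite ler_wpM2l// gerBl G0//; lra.
  have h2 : s * G c <= (b2 - b1) / c * G c.
    rewrite ler_wpM2r ?G0// ler_wpM2l ?lef_pV2 ?posrE//; lra.
  have h3 : G b1 - G b2 <= (b2 - b1) / c * G c by lra.
  have := ler_wpM2l (_ : 0 <= b2 - b1) h3; rewrite subr_ge0 => /(_ (ltW b12)).
  by move=> h4; apply: le_trans h4 _; rewrite le_eqVlt; apply/orP; left; apply/eqP; ring.
have b_gt0 : 0 < t * b1 + (1 - t) * b2.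
  have := ler_wpM2l t0 b01; have := ler_wpM2l (_ : 0 <= 1 - t) b02.
  by rewrite subr_ge0 => /(_ t1); lra.
have b1_gt0 := lt_le_trans b00 b01; have b2_gt0 := lt_le_trans b00 b02.
have hG := Gconv _ _ _ b1_gt0 b2_gt0 t01 b_gt0.
rewrite (FG _ b1_gt0) (FG _ b2_gt0) (FG _ b_gt0); clearbody G; have := ler_wpM2l (ltW b_gt0) hG.
have tt : 0 <= t * (1 - t) by rewrite mulr_ge0 ?subr_ge0.
by have := ler_wpM2l tt key; lra.
Qed.

Lemma band_rate_smooth_slope : exists mu, smooth_slope (band_rate E m) mu.
Proof.
exact: smooth_slope_exists band_rate_strictly_concave band_rate_semiconvex.
Qed.

Lemma band_rate_continuous : continuous (fun b : R => band_rate E m (Num.max 0 b)).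
Proof.
have [mu hmu] := band_rate_smooth_slope.
apply: (concave_ray_continuous _ _ _ _ hmu).
- by rewrite /band_rate mul0r.
- exact: band_rate_ge0.
- move=> b y; exact: (concave_ray_nondecr band_rate_strictly_concave band_rate_ge0).
- exact: band_rate_small.
Qed.

End mode_rate.

(** * Utilities *)

Lemma ln_concave (R : realType) (p q t : R) : 0 < p -> 0 < q -> 0 <= t <= 1 ->
  t * ln p + (1 - t) * ln q <= ln (t * p + (1 - t) * q).
Proof.
move=> p0 q0 t01; have /andP[t0 t1] := t01.
set c := t * p + _; have c0 : 0 < c.
  move: t0; rewrite le_eqVlt => /predU1P[t0|t0]; first by rewrite /c -t0 mul0r add0r subr0 mul1r.
  by rewrite ltr_pwDl ?mulr_gt0// mulr_ge0 ?subr_ge0// ltW.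
have h1 := ler_wpM2l t0 (ln_le_tangent c0 p0).
have h2 := ler_wpM2l (_ : 0 <= 1 - t) (ln_le_tangent c0 q0).
rewrite subr_ge0 in h2; have {}h2 := h2 t1.
have e : t * ((p - c) / c) + (1 - t) * ((q - c) / c) = 0.
  rewrite !mulrA -mulrDl (_ : _ + _ = 0) ?mul0r//.
  by rewrite /c; ring.
lra.
Qed.

Section own_spectrum.
Variables (R : realType) (sch : intra_scheme) (Fc Fd : R -> R) (k delta M : R).
Implicit Types x y t : R.

Definition cell_share x := match sch with Overlay => k | Underlay => own_band x end.

Definition intra_share x :=
  match sch with Overlay => own_band x - k | Underlay => own_band x end.

Definition own_rate x := Fc (cell_share x) * (1 - delta) + Fd (intra_share x) * delta.

Hypotheses (Fc_concave : strictly_concave_ray Fc) (Fc_ge0 : forall b, 0 <= b -> 0 <= Fc b).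
Hypotheses (Fd_concave : strictly_concave_ray Fd) (Fd_ge0 : forall b, 0 <= b -> 0 <= Fd b).
Hypotheses (delta_gt0 : 0 < delta) (delta_le1 : delta <= 1).
Hypotheses (M_le1 : M <= 1) (intra_share_M : 0 <= intra_share M).

Let own_band_ge0 x : x <= M -> 0 <= own_band x.
Proof. by rewrite /own_band => xM; rewrite subr_ge0 (le_trans xM). Qed.

Let intra_share_ge0 x : x <= M -> 0 <= intra_share x.
Proof. by move: intra_share_M; rewrite /intra_share /own_band; case: sch; lra. Qed.

Let intra_share_affine x y t :
  intra_share (t * x + (1 - t) * y) = t * intra_share x + (1 - t) * intra_share y.
Proof. by rewrite /intra_share /own_band; case: sch; ring. Qed.

Let intra_share_decr x y : x < y -> intra_share y < intra_share x.
Proof. by rewrite /intra_share /own_band; case: sch; lra. Qed.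

Lemma own_rate_nonincr x y : x <= y -> y <= M -> own_rate y <= own_rate x.
Proof.
move=> xy yM; rewrite /own_rate lerD//.
  rewrite ler_wpM2r ?subr_ge0// /cell_share; case: sch => //.
  by apply: concave_ray_nondecr => //; [exact: own_band_ge0|rewrite lerD2l lerN2].
rewrite ler_wpM2r ?(ltW delta_gt0)// concave_ray_nondecr ?intra_share_ge0//.
by move: xy; rewrite le_eqVlt => /predU1P[->//|/intra_share_decr/ltW].
Qed.

Let cell_concave x y t : x <= M -> y <= M -> 0 <= t <= 1 ->
  t * Fc (cell_share x) + (1 - t) * Fc (cell_share y) <=
    Fc (cell_share (t * x + (1 - t) * y)).
Proof.
move=> /own_band_ge0 x1 /own_band_ge0 y1 t01; rewrite /cell_share.
case: sch; first by rewrite -mulrDl subrKC mul1r.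
rewrite (_ : own_band (t * x + _) = t * own_band x + (1 - t) * own_band y).
  exact: concave_ray_le.
by rewrite /own_band; ring.
Qed.

Lemma own_rate_concave x y t : x <= M -> y <= M -> 0 <= t <= 1 ->
  t * own_rate x + (1 - t) * own_rate y <= own_rate (t * x + (1 - t) * y).
Proof.
move=> xM yM t01; rewrite /own_rate intra_share_affine.
have h1 := cell_concave xM yM t01.
have h2 := concave_ray_le Fd_concave (intra_share_ge0 xM) (intra_share_ge0 yM) t01.
have := ler_wpM2r (ltW delta_gt0) h2.
have := ler_wpM2r (_ : 0 <= 1 - delta) h1.
rewrite subr_ge0 => /(_ delta_le1); lra.
Qed.

(** Strictness comes from the intra-operator term: its band decreases strictly in x under both
    schemes, and delta > 0. Midpoints are all that uniqueness of maximizers requires. *)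
Lemma own_rate_midpoint x y : x < y -> y <= M ->
  2^-1 * own_rate x + 2^-1 * own_rate y < own_rate (2^-1 * x + 2^-1 * y).
Proof.
move=> xy yM; have xM := le_trans (ltW xy) yM.
have half : 0 <= (2^-1 : R) <= 1 by lra.
have half' : 0 < (2^-1 : R) < 1 by lra.
have hE : 1 - 2^-1 = 2^-1 :> R by field.
have h1 := cell_concave xM yM half.
have h2 := Fd_concave (intra_share_ge0 yM) (intra_share_decr xy) half'.
have h3 := intra_share_affine x y 2^-1.
rewrite hE in h1 h2 h3; rewrite /own_rate h3.
rewrite [2^-1 * intra_share y + _]addrC in h2; rewrite -(ltr_pM2r delta_gt0) in h2.
have := ler_wpM2r (_ : 0 <= 1 - delta) h1.
rewrite subr_ge0 => /(_ delta_le1); lra.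
Qed.

Lemma own_rate_continuous m : continuous (fun b : R => Fc (Num.max 0 b)) ->
  continuous (fun b : R => Fd (Num.max 0 b)) ->
  {within `[m, M], continuous own_rate}.
Proof.
move=> cFc cFd.
(* A function continuous on the whole line that agrees with [own_rate] up to M, where both bands are
   nonnegative. *)
pose g x := (match sch with Overlay => Fc k | Underlay => Fc (Num.max 0 (own_band x)) end)
  * (1 - delta) + Fd (Num.max 0 (intra_share x)) * delta.
have cown : continuous (@own_band R).
  by move=> x; apply: cvgB; [exact: cvg_cst|exact: cvg_id].
have gE x : x <= M -> g x = own_rate x.
  move=> xM; rewrite /g /own_rate /cell_share (max_r (intra_share_ge0 xM)).
  by case: sch => //; rewrite (max_r (own_band_ge0 xM)).
apply: (@subspace_eq_continuous _ _ _ g).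
  by move=> x; rewrite inE /= in_itv/= => /andP[_]; exact: gE.
apply: continuous_subspaceT => x; apply: cvgD.
  apply: cvgM; last exact: cvg_cst.
  case: sch; first exact: cvg_cst.
  exact: (continuous_comp (cown x) (cFc _)).
apply: cvgM; last exact: cvg_cst.
have cintra : {for x, continuous intra_share}.
  rewrite /intra_share; case: sch; last exact: cown.
  by apply: cvgB; [exact: cown|exact: cvg_cst].
exact: (continuous_comp cintra (cFd _)).
Qed.

End own_spectrum.

(** * Sum-rate and proportional-fair utilities *)

Section utilities.
Variables (R : realType) (kd : utility_kind) (w : R).
Hypotheses (w_ge0 : 0 <= w) (w_le1 : w <= 1).
Implicit Types x y t lam : R.

Definition own_utility (Q : R -> R) x :=
  (1 - w) * match kd with SumRate => Q x | ProportionalFair => ln (Q x) end.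

Definition pool_utility (F : R -> R) x :=
  w * match kd with SumRate => F x | ProportionalFair => ln (F x) end.

Definition pool_slope (F mu : R -> R) x :=
  w * match kd with SumRate => mu x | ProportionalFair => mu x / F x end.

Lemma pool_utility_smooth F mu : strictly_concave_ray F ->
  (forall b, 0 <= b -> 0 <= F b) -> smooth_slope F mu ->
  smooth_slope (pool_utility F) (pool_slope F mu).
Proof.
move=> Fc F0 Fmu; apply: smooth_slopeZ => //; case: kd => //.
apply: smooth_slope_ln => // b; first exact: concave_ray_gt0.
by move=> y b0; exact: (concave_ray_nondecr Fc F0 (ltW b0)).
Qed.

(** For operators of weight 1, whose own utility vanishes. The slope of F at b exceeds 0 because the
    tangent there lies above the strictly larger value at b + 1. *)
Lemma pool_slope_gt0 F mu b : strictly_concave_ray F ->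
  (forall b, 0 <= b -> 0 <= F b) -> smooth_slope F mu -> 0 < w -> 0 < b ->
  0 < pool_slope F mu b.
Proof.
move=> Fc F0 [Fmu _] w0 b0; have b1 : b < b + 1 by lra.
have mu0 : 0 < mu b.
  have := Fmu b (b + 1) b0 (lt_trans b0 b1).
  have := concave_ray_incr Fc F0 (ltW b0) b1.
  by rewrite [b + 1 - b]addrAC subrr add0r mulr1; lra.
rewrite mulr_gt0//; case: kd => //.
by rewrite divr_gt0// concave_ray_gt0.
Qed.

Variables (Q : R -> R) (m M : R).
Let S : set R := `[m, M].
Hypothesis Q_gt0 : forall x, S x -> 0 < Q x.
Hypothesis Q_concave : forall x y t, S x -> S y -> 0 <= t <= 1 ->
  t * Q x + (1 - t) * Q y <= Q (t * x + (1 - t) * y).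
Hypothesis Q_midpoint : forall x y, S x -> S y -> x < y ->
  2^-1 * Q x + 2^-1 * Q y < Q (2^-1 * x + 2^-1 * y).
Hypothesis Q_continuous : {within S, continuous Q}.

Lemma own_utility_concave x y t : S x -> S y -> 0 <= t <= 1 ->
  t * own_utility Q x + (1 - t) * own_utility Q y <= own_utility Q (t * x + (1 - t) * y).
Proof.
move=> Sx Sy t01; have Qc := Q_concave Sx Sy t01.
have w' : 0 <= 1 - w by rewrite subr_ge0.
rewrite /own_utility; case: kd; first by have := ler_wpM2l w' Qc; lra.
have lnc := ln_concave (Q_gt0 Sx) (Q_gt0 Sy) t01.
have c0 : 0 < t * Q x + (1 - t) * Q y.
  have := Q_gt0 Sx; have := Q_gt0 Sy; have /andP[t0 t1] := t01 => y0 x0.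
  move: t0; rewrite le_eqVlt => /predU1P[<-|t0]; first by rewrite mul0r add0r subr0 mul1r.
  by rewrite ltr_pwDl ?mulr_gt0// mulr_ge0 ?subr_ge0// ltW.
have Qz := lt_le_trans c0 Qc.
have : ln (t * Q x + (1 - t) * Q y) <= ln (Q (t * x + (1 - t) * y)).
  by rewrite ler_ln ?posrE.
by move=> /(le_trans lnc)/(ler_wpM2l w'); lra.
Qed.

Lemma own_utility_continuous : {within S, continuous (own_utility Q)}.
Proof.
move=> x; apply: cvgM; first exact: cvg_cst.
case: kd; first exact: Q_continuous.
move: x; apply/subspace_continuousP => x Sx.
have /subspace_continuousP/(_ _ Sx) Qx := Q_continuous.
apply: (cvg_comp _ _ Qx); exact: (continuous_ln (Q_gt0 Sx)).
Qed.

(** For w = 1 the objective is lam * x, strictly increasing. Otherwise the midpoint of two distinct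
    maximizers would be strictly better than both. *)
Lemma own_utility_unique lam x y : (w = 1 -> 0 < lam) -> S x -> S y ->
  (forall z, S z -> own_utility Q z + lam * z <= own_utility Q x + lam * x) ->
  (forall z, S z -> own_utility Q z + lam * z <= own_utility Q y + lam * y) -> x = y.
Proof.
move=> lam0.
wlog xy : x y / x < y.
  move=> hw Sx Sy hx hy; have [xy|yx|//] := ltgtP x y; first exact: hw.
  by apply/esym; apply: hw.
move=> Sx Sy hx hy; exfalso.
have [w1|wn1] := eqVneq w 1.
  have := hx _ Sy; rewrite /own_utility w1 subrr !mul0r !add0r.
  by rewrite ler_pM2l ?lam0// leNgt xy.
have w' : 0 < 1 - w by rewrite subr_gt0 lt_neqAle wn1.
have half : 0 <= (2^-1 : R) <= 1 by lra.
have hE : 1 - 2^-1 = 2^-1 :> R by field.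
have Sz := itv_conv Sx Sy half; rewrite hE in Sz.
have Qz := Q_midpoint Sx Sy xy.
set z := 2^-1 * x + _ in Sz Qz.
have Az : 2^-1 * own_utility Q x + 2^-1 * own_utility Q y < own_utility Q z.
  rewrite /own_utility; case: kd; first by rewrite -(ltr_pM2l w') in Qz; lra.
  have := ln_concave (Q_gt0 Sx) (Q_gt0 Sy) half; rewrite hE => lnc.
  have : ln (2^-1 * Q x + 2^-1 * Q y) < ln (Q z).
    rewrite ltr_ln// posrE ?Q_gt0// addr_gt0// mulr_gt0 ?invr_gt0// Q_gt0//.
  by move=> /(le_lt_trans lnc); rewrite -(ltr_pM2l w'); lra.
have := hx _ Sz; have := hy _ Sz.
have : lam * z = 2^-1 * (lam * x) + 2^-1 * (lam * y) by rewrite /z; ring.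
lra.
Qed.

End utilities.

(** * The spectrum game as an aggregative game *)

Section spectrum_game.
Context (R : realType) (d : measure_display) (T : measurableType d)
  (P : probability T R) (N : nat) (G : game P N).

Definition game_own_rate (i : 'I_N) : R -> R :=
  own_rate (scheme G i) (band_rate (env G) (cell_mode G i))
    (band_rate (env G) (intra_mode G i)) (overlay_cell_band G i) (intra_fraction G i).

Definition game_own_utility (i : 'I_N) : R -> R :=
  own_utility (kind G i) (weight G i) (game_own_rate i).

Definition game_pool_utility (i : 'I_N) : R -> R :=
  pool_utility (kind G i) (weight G i) (band_rate (env G) (inter_mode G)).

(** With q = 1 the inter-operator rate depends on the profile through the pool alone; otherwise the
    proportional-fair logarithm would mix the cellular rate with the pool. *)
Lemma utility_split (i : 'I_N) (beta : 'I_N -> R) : inter_fraction G = 1 ->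
  utility G i beta = game_own_utility i (beta i) + game_pool_utility i (pool beta).
Proof.
move=> hq.
have Qd : intra_rate G i (beta i) = game_own_rate i (beta i) by [].
have Qs : inter_rate G i beta = band_rate (env G) (inter_mode G) (pool beta).
  rewrite /inter_rate hq; move: (cell_rate _ _ _) (band_rate _ _ _) => u v.
  by rewrite subrr mulr0 add0r mulr1.
rewrite /utility Qd Qs /game_own_utility /game_pool_utility /own_utility /pool_utility.
by case: (kind G i).
Qed.

Lemma pool_deviate (beta : 'I_N -> R) (i : 'I_N) (x : R) :
  pool (deviate beta i x) = \sum_j beta j - beta i + x.
Proof.
rewrite /pool (bigD1 i)//= [in RHS](bigD1 i)//= /deviate /= eqxx.
rewrite [in RHS](addrC (beta i)) addrK [RHS]addrC; congr (_ + _).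
by apply: eq_bigr => j /negbTE ->.
Qed.

Lemma nash_aggregative (beta : 'I_N -> R) : inter_fraction G = 1 ->
  nash G beta <->
  aggregative_equilibrium (min_contribution G) (max_contribution G)
    game_own_utility game_pool_utility beta.
Proof.
move=> hq.
have at_beta i := utility_split i beta hq.
have at_deviation i x : utility G i (deviate beta i x) =
    game_own_utility i x + game_pool_utility i (\sum_j beta j - beta i + x).
  by rewrite (utility_split _ _ hq) pool_deviate {1}/deviate [X in game_own_utility _ X]/= eqxx.
split=> -[Sb best]; (split; first exact: Sb) => i x Sx.
  by have := best i x Sx; rewrite at_beta at_deviation.
by rewrite at_beta at_deviation; exact: best.
Qed.

End spectrum_game.

Theorem proposition9 (R : realType) (d : measure_display)
    (T : measurableType d) (P : probability T R) (N : nat) (G : game P N)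
    (hG : game_ok G) (hq : inter_fraction G = 1)
    (hconcave : forall i : 'I_N, concave_utility G i) :
  exists! beta : 'I_N -> R, nash G beta.
Proof.
have Eok := env_ok hG; have sok := inter_mode_ok hG.
have Fs_c := band_rate_strictly_concave Eok sok.
have Fs_0 := @band_rate_ge0 _ _ _ _ _ _ Eok sok.
have [mu Fs_mu] := band_rate_smooth_slope Eok sok.
pose lam i := pool_slope (kind G i) (weight G i) (band_rate (env G) (inter_mode G)) mu.
have lam_smooth i : smooth_slope (game_pool_utility G i) (lam i).
  exact: (pool_utility_smooth _ (weight_ge0 hG i) Fs_c Fs_0 Fs_mu).
have lam_gt0 i B : weight G i = 1 -> 0 < B -> 0 < lam i B.
  by move=> w1; apply: (pool_slope_gt0 _ Fs_c Fs_0 Fs_mu); rewrite w1.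
have M_le1 i : max_contribution G i <= 1.
  by have [/andP[]] := max_contribution_feasible hG i.
have M_intra i : 0 <= intra_share (scheme G i) (overlay_cell_band G i) (max_contribution G i).
  by have [] := max_contribution_feasible hG i.
have Fd_c i := band_rate_strictly_concave Eok (intra_mode_ok hG i).
have Fc_c i := band_rate_strictly_concave Eok (cell_mode_ok hG i).
have Fd_0 i := @band_rate_ge0 _ _ _ _ _ _ Eok (intra_mode_ok hG i).
have Fc_0 i := @band_rate_ge0 _ _ _ _ _ _ Eok (cell_mode_ok hG i).
have delta_gt0 := intra_fraction_gt0 hG; have delta_le1 := intra_fraction_le1 hG.
have S_le i x : strategies G i x -> x <= max_contribution G i.
  by rewrite /strategies /= in_itv/= => /andP[].
(* The own rate falls as the contribution grows, so meeting the positive target at the largest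
   contribution bounds it from below on the whole strategy set; this makes its logarithm
   meaningful. *)
have Q_gt0 i x : strategies G i x -> 0 < game_own_rate G i x.
  move=> /S_le xM; apply: lt_le_trans (intra_target_gt0 hG i) _.
  have [_ _ _ /le_trans] := max_contribution_feasible hG i; apply.
  exact: (own_rate_nonincr (Fc_c i) (Fc_0 i) (Fd_c i) (Fd_0 i)).
have Q_concave i x y t : strategies G i x -> strategies G i y -> 0 <= t <= 1 ->
    t * game_own_rate G i x + (1 - t) * game_own_rate G i y <=
    game_own_rate G i (t * x + (1 - t) * y).
  by move=> /S_le xM /S_le yM; exact: (own_rate_concave (Fc_c i) (Fd_c i)).
have Q_midpoint i x y : strategies G i x -> strategies G i y -> x < y ->
    2^-1 * game_own_rate G i x + 2^-1 * game_own_rate G i y <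
    game_own_rate G i (2^-1 * x + 2^-1 * y).
  by move=> _ /S_le yM xy; exact: (own_rate_midpoint (Fc_c i) (Fd_c i)).
have Q_continuous i : {within strategies G i, continuous (game_own_rate G i)}.
  apply: own_rate_continuous => //.
  - exact: band_rate_continuous Eok (cell_mode_ok hG i).
  - exact: band_rate_continuous Eok (intra_mode_ok hG i).
have [beta [beta_eq beta_uniq]] : exists! beta, aggregative_equilibrium
    (min_contribution G) (max_contribution G) (game_own_utility G) (game_pool_utility G) beta.
  apply: (@aggregative_equilibrium_unique _ _ _ _ _ _ lam) => //.
  - exact: min_contribution_gt0 hG.
  - exact: min_le_max_contribution hG.
  - by move=> i; exact: (@own_utility_continuous R (kind G i) (weight G i) (game_own_rate G i)
      (min_contribution G i) (max_contribution G i) (@Q_gt0 i) (Q_continuous i)).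
  - move=> i x y t; exact: (own_utility_concave _ (weight_le1 hG i) (@Q_gt0 i) (Q_concave i)).
  - move=> i B x y B0 [Sx hx] [Sy hy].
    exact: (@own_utility_unique R (kind G i) (weight G i) (weight_le1 hG i)
      (game_own_rate G i) (min_contribution G i) (max_contribution G i) (@Q_gt0 i)
      (Q_midpoint i) (lam i B) x y (fun w1 => lam_gt0 i B w1 B0) Sx Sy hx hy).
exists beta; split; first exact/nash_aggregative.
by move=> beta' /nash_aggregative beta'_eq; apply: beta_uniq; exact: beta'_eq.
Qed.
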